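(* There exists a distribution over linear mappings $T:L_1\to L_2$ (that is, a probability space $(\Omega,P)$ and a family $(T_\omega)_{\omega\in\Omega}$ of linear mappings $T_\omega:L_1\to L_2$) such that for every $x\in L_1\setminus\{0\}$ the random variable $\omega\mapsto \frac{\|T_\omega(x)\|_2}{\|x\|_1}$ has density $t\mapsto \frac{e^{-1/(4t^2)}}{t^2\sqrt{\pi}}$ on $(0,\infty)$.
   Context: $L_p$ denotes the real space $L_p[0,1]$ (with Lebesgue measure) with its usual norm $\|\cdot\|_p$; $L_2$ serves as a Hilbert space. *)

(* Defs.v *)
From HB Require Import structures.
From mathcomp Require Import all_boot all_order all_algebra.
From mathcomp Require Import all_classical all_reals all_analysis.
From mathcomp Require Import measurable_realfun ess_sup_inf.

Set Implicit Arguments.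
Unset Strict Implicit.
Unset Printing Implicit Defensive.

Import Order.TTheory GRing.Theory Num.Theory.
Import numFieldNormedType.Exports.

Local Open Scope classical_set_scope.
Local Open Scope ring_scope.

(** The library's [LspaceType mu p1] is the type of ae-equality classes of
    measurable functions with finite p-norm; it comes without any algebraic
    structure.  We equip it with the pointwise operations and with the p-norm,
    making it a [normedModType R]. *)
Section Lspace_structure.
Context d (T : measurableType d) (R : realType).
Variables (mu : {measure set T -> \bar R}) (p : \bar R) (p1 : (1 <= p)%E).
Local Notation Lp := (LspaceType mu p1).
Local Notation Lfn := (LfunType mu p1).

HB.instance Definition _ := gen_eqMixin Lp.
HB.instance Definition _ := gen_choiceMixin Lp.

Lemma eq_ae_Lnorm (f g : {mfun T >-> measurableTypeR R}) :
  (f : T -> R) = g %[ae mu] ->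
  ('N[mu]_p[EFin \o (f : T -> R)] = 'N[mu]_p[EFin \o (g : T -> R)])%E.
Proof.
move=> fg; rewrite unlock /Lnorm.
move: p p1 => [r| |] // _; last first.
  case: ifPn => // _; apply: eq_ess_sup.
  by apply: filterS fg => x /(_ I) /= ->.
have mpow (h : {mfun T >-> measurableTypeR R}) :
    measurable_fun [set: T] (fun x => `|(EFin \o (h : T -> R)) x| `^ r)%E.
  apply: (@measurableT_comp _ _ _ _ _ _ (fun y : \bar R => (y `^ r)%E) _
    (fun x => `|(h x : R)%:E|%E)); first exact: measurable_poweR.
  apply: measurableT_comp => //; apply/measurable_EFinP.
  exact: (measurable_funPT h).
congr poweR; apply: ge0_ae_eq_integral => //; try exact: mpow.
- by move=> x _; exact: poweR_ge0.
- by move=> x _; exact: poweR_ge0.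
- by apply: filterS fg => x /(_ I) /= ->.
Qed.

(* [LfunType] and [LspaceType] are built on two convertible but syntactically
   different Borel structures on [R] *)
Lemma Lfun_measurableTypeR (f : Lfn) :
  measurable_fun [set: T] (f : T -> measurableTypeR R).
Proof. exact: (measurable_funPT (f : {mfun T >-> R})). Qed.

Definition mfun_of_Lfun (f : Lfn) : {mfun T >-> measurableTypeR R} :=
  HB.pack_for {mfun T >-> measurableTypeR R} (f : T -> R)
    (isMeasurableFun.Build _ _ T (measurableTypeR R) (f : T -> R)
       (Lfun_measurableTypeR f)).

Definition Lclass_mfun (f : Lfn) : {mfun_ mu, T >-> measurableTypeR R} :=
  (\pi_({mfun_ mu, T >-> measurableTypeR R}) (mfun_of_Lfun f))%qT.

Lemma Lclass_mfunE (f : Lfn) : (Lclass_mfun f : T -> R) = f %[ae mu].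
Proof.
rewrite /Lclass_mfun /aqEqMfun_to_fun.
have /eqP := reprK (\pi_({mfun_ mu, T >-> measurableTypeR R}) (mfun_of_Lfun f))%qT.
by rewrite eqmodE => /asboolP.
Qed.

Lemma Lclass_finite_norm (f : Lfn) : finite_norm mu p (Lclass_mfun f).
Proof.
rewrite /finite_norm (eq_ae_Lnorm (g := mfun_of_Lfun f) (Lclass_mfunE f)).
exact: (@Lfunction_finite _ _ _ _ _ p1 f).
Qed.

Definition Lclass (f : Lfn) : Lp :=
  LebesgueSpace.Pack
    (LebesgueSpace.Class (isFinLebesgue.Build _ _ _ mu p p1 _ (Lclass_finite_norm f))).

Lemma Lrepr_subproof (f : Lp) : (f : T -> R) \in Lfun mu p.
Proof.
apply/andP; split; rewrite inE /=.
  exact: (measurable_funPT (repr (f : {mfun_ mu, T >-> measurableTypeR R}))).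
exact: Lebesgue_finite.
Qed.

(* the representative chosen by the coercion of [Lp] to functions *)
Definition Lrepr (f : Lp) : Lfn := Lfun_Sub p1 (Lrepr_subproof f).

Lemma LreprE (f : Lp) : Lrepr f = f :> (T -> R).
Proof. by []. Qed.

Lemma LclassE (f : Lfn) : (Lclass f : T -> R) = f %[ae mu].
Proof. exact: Lclass_mfunE. Qed.

Lemma Lspace_eqP (f g : Lp) : (f : T -> R) = g %[ae mu] <-> f = g.
Proof.
split=> [fg|->]; last exact: (ae_eq_refl mu setT (g : T -> R)).
have {fg} : f = g :> {mfun_ mu, T >-> measurableTypeR R}.
  by rewrite -[LHS]reprK -[RHS]reprK; apply/eqmodP/asboolP.
case: f g => [f [[pf]]] [g [[pg]]] /= fg.
by rewrite fg in pf *; rewrite (Prop_irrelevance pf pg).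
Qed.

Lemma LclassP (f g : Lfn) : (f : T -> R) = g %[ae mu] <-> Lclass f = Lclass g.
Proof.
rewrite -Lspace_eqP; split=> h.
  apply: ae_eq_trans (LclassE f) _.
  by apply: ae_eq_trans h _; apply: ae_eq_sym; exact: LclassE.
apply: ae_eq_trans (LclassE g); apply: ae_eq_trans h.
by apply: ae_eq_sym; exact: LclassE.
Qed.

Lemma LreprK : cancel Lrepr Lclass.
Proof. by move=> f; apply/Lspace_eqP; exact: LclassE. Qed.

Definition Lspace_zero : Lp := Lclass 0.
Definition Lspace_opp (f : Lp) : Lp := Lclass (- Lrepr f).
Definition Lspace_add (f g : Lp) : Lp := Lclass (Lrepr f + Lrepr g).
Definition Lspace_scale (a : R) (f : Lp) : Lp := Lclass (a *: Lrepr f).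

Lemma Lclass_add (f g : Lfn) :
  Lspace_add (Lclass f) (Lclass g) = Lclass (f + g).
Proof.
apply/LclassP; apply: filterS2 (LclassE f) (LclassE g) => x fx gx _.
exact: (f_equal2 +%R (fx I) (gx I)).
Qed.

Lemma Lclass_opp (f : Lfn) : Lspace_opp (Lclass f) = Lclass (- f).
Proof.
apply/LclassP; apply: filterS (LclassE f) => x fx _.
exact: (f_equal -%R (fx I)).
Qed.

Lemma Lclass_scale a (f : Lfn) : Lspace_scale a (Lclass f) = Lclass (a *: f).
Proof.
apply/LclassP; apply: filterS (LclassE f) => x fx _.
exact: (f_equal ( *%R a) (fx I)).
Qed.

Lemma Lspace_addA : associative Lspace_add.
Proof.
move=> f g h; rewrite -(LreprK f) -(LreprK g) -(LreprK h).
by rewrite !Lclass_add addrA.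
Qed.

Lemma Lspace_addC : commutative Lspace_add.
Proof. by move=> f g; rewrite /Lspace_add addrC. Qed.

Lemma Lspace_add0 : left_id Lspace_zero Lspace_add.
Proof. by move=> f; rewrite -(LreprK f) Lclass_add add0r. Qed.

Lemma Lspace_addN : left_inverse Lspace_zero Lspace_opp Lspace_add.
Proof. by move=> f; rewrite -(LreprK f) Lclass_opp Lclass_add addNr. Qed.

HB.instance Definition _ := GRing.isZmodule.Build Lp
  Lspace_addA Lspace_addC Lspace_add0 Lspace_addN.

Lemma Lspace_scaleA a b (f : Lp) :
  Lspace_scale a (Lspace_scale b f) = Lspace_scale (a * b) f.
Proof. by rewrite -(LreprK f) !Lclass_scale scalerA. Qed.

Lemma Lspace_scale1 : left_id 1 Lspace_scale.
Proof. by move=> f; rewrite /Lspace_scale scale1r LreprK. Qed.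

Lemma Lspace_scaleDr : right_distributive Lspace_scale +%R.
Proof.
move=> a f g; rewrite -(LreprK f) -(LreprK g).
have -> : Lclass (Lrepr f) + Lclass (Lrepr g) = Lclass (Lrepr f + Lrepr g).
  exact: Lclass_add.
by rewrite !Lclass_scale scalerDr -Lclass_add.
Qed.

Lemma Lspace_scaleDl (f : Lp) : {morph Lspace_scale^~ f : a b / a + b}.
Proof.
move=> a b; rewrite -(LreprK f) !Lclass_scale scalerDl.
by rewrite -Lclass_add.
Qed.

HB.instance Definition _ := GRing.Zmodule_isLmodule.Build R Lp
  Lspace_scaleA Lspace_scale1 Lspace_scaleDr Lspace_scaleDl.

Definition Lspace_norm (f : Lp) : R := fine 'N[mu]_p[EFin \o (f : T -> R)].

Lemma Lspace_norm_class (f : Lfn) :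
  Lspace_norm (Lclass f) = fine 'N[mu]_p[EFin \o (f : T -> R)].
Proof. by rewrite /Lspace_norm (eq_ae_Lnorm (g := mfun_of_Lfun f) (LclassE f)). Qed.

Lemma Lspace_normD (f g : Lp) :
  Lspace_norm (f + g) <= Lspace_norm f + Lspace_norm g.
Proof.
rewrite [leLHS]Lspace_norm_class; exact: (ler_LnormD (Lrepr f) (Lrepr g)).
Qed.

Lemma Lspace_normZ (a : R) (f : Lp) :
  Lspace_norm (a *: f) = `|a| * Lspace_norm f.
Proof.
rewrite [LHS]Lspace_norm_class; apply: EFin_inj.
rewrite EFinM /Lspace_norm -(LreprE f) !(finite_norm_fine (p1 := p1)).
exact: LnormZ.
Qed.

Lemma Lspace_norm0_eq0 (f : Lp) : Lspace_norm f = 0 -> f = 0.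
Proof.
move=> f0; have h := @fine_Lnormr_eq0 _ _ _ _ _ _ (Lrepr f) f0.
by rewrite -(LreprK f); apply/LclassP; exact: h.
Qed.

HB.instance Definition _ := Lmodule_isNormed.Build R Lp
  Lspace_normD Lspace_normZ Lspace_norm0_eq0.

End Lspace_structure.

Section unit_interval_Lp.
Variable R : realType.

(* Lebesgue measure on [0,1], as a measure on the line: functions are
   identified as soon as they agree almost everywhere on [0,1] *)
Definition lebesgue01 : {measure set (measurableTypeR R) -> \bar R} :=
  mrestr lebesgue_measure (measurable_itv `[0%R, 1%R]%R).

Definition L1 := LspaceType1 lebesgue01.
Definition L2 := LspaceType2 lebesgue01.
End unit_interval_Lp.

(* [X] is a random variable whose law is carried by [D] and has density [f]
   there with respect to Lebesgue measure *)
Definition has_density_on d (Omega : measurableType d) (R : realType)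
    (P : probability Omega R) (X : Omega -> R) (D : set R) (f : R -> R) : Prop :=
  [/\ measurable_fun [set: Omega] X,
      measurable D,
      measurable_fun D f,
      (forall t, D t -> 0 <= f t)
    & forall A : set R, measurable A ->
        P (X @^-1` A) = (\int[lebesgue_measure]_(t in A `&` D) (f t)%:E)%E].

(* Main.v *)
Require Import Defs.
From HB Require Import structures.
From mathcomp Require Import all_boot all_order all_algebra.
From mathcomp Require Import all_classical all_reals all_analysis measurable_realfun.
From mathcomp Require Import ring lra.

Set Implicit Arguments.
Unset Strict Implicit.
Unset Printing Implicit Defensive.

Import Order.TTheory GRing.Theory Num.Theory.
Import numFieldNormedType.Exports.

Local Open Scope classical_set_scope.
Local Open Scope ring_scope.

(**
  Take a Poisson point process of unit intensity on [0, +oo[ * [0, 1], with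
  points (r_j, u_j), and put T x = (x(u_j) / (kappa r_j))_j in l2, which embeds
  isometrically into L2.  The exponential formula gives

    E exp(- l |T x|^2) = exp(- int int (1 - exp(- l x(u)^2 / (kappa r)^2)) dr du)
                       = exp(- sqrt l |x|_1)

  when kappa = int_0^oo (1 - exp(- 1 / r^2)) dr, by scaling in r.  This is
  also the Laplace transform of (|x|_1 t)^2 when t has the target density (by the
  Cauchy-Schloemilch substitution y = l t - 1 / (2 t)), and a Laplace transform
  determines the law.

  The process is built shell by shell: the points with k <= r < k + 1 are a
  Poisson(1) number of independent uniform ones.  All the independent uniform
  variables are extracted from one point of [0, 1], whose even and odd binary
  digits give two independent uniform numbers.

  For a fixed x the coordinates are in l2 only almost surely, and they depend on
  the choice of a representative of x.  So "tau is a version of the random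
  vector T x" is a linear relation between x and tau : Omega -> L2, and Zorn's
  lemma provides a linear selection of it, which is linear for every omega.
*)

(** * Linear selections *)

(** Under the target density t^2 has the one-sided 1/2-stable law, and the values 1 / (kappa r)^2 at
    unit-intensity points r are its jumps: their intensity is proportional to s^(-3/2) ds. Weighting
    a jump by c^2 amounts to scaling r by |c|, which costs a factor |c|; this is how an L1 norm
    comes out of an l2 norm. The obstacle is linearity for every omega. Each x has its own
    exceptional null set and there are uncountably many x, so no common null set can be discarded.
    Changing T x on a null set does not change its law, however, and versions for x and y combine to
    versions for a x + y; a selection needs no more than this. Expectations are computed exactly for
    finitely many shells with boundedly many points each, where they are finite products, and limits
    come afterwards. *)

Lemma linear_selection (K : fieldType) (V W : lmodType K) (Q : V -> W -> Prop) :
  (forall a x y v w, Q x v -> Q y w -> Q (a *: x + y) (a *: v + w)) ->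
  (forall x, exists w, Q x w) ->
  exists T : {linear V -> W}, forall x, Q x (T x).
Proof.
move=> Qlin Qtot.
(* Partial selections are encoded by their graphs. The empty graph qualifies, as the union of an
   empty chain must; that the maximal graph contains (0, 0) is therefore derived separately. *)
pose P (G : set (V * W)) := [/\ G `<=` [set z | Q z.1 z.2],
  forall a z t, G z -> G t -> G (a *: z + t) &
  forall x v w, G (x, v) -> G (x, w) -> v = w].
have [|A [[AQ Alin Afun] Amax]] := @Zorn_bigcup _ P.
  move=> F FP Ftot; split.
  - by move=> z [X FX Xz]; have [+ _ _] := FP _ FX; exact.
  - move=> a z t [X FX Xz] [Y FY Yt].
    have [XY|YX] := Ftot _ _ FX FY.
      by exists Y => //; have [_ + _] := FP _ FY; apply=> //; exact: XY.
    by exists X => //; have [_ + _] := FP _ FX; apply=> //; exact: YX.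
  - move=> x v w [X FX Xz] [Y FY Yt].
    have [XY|YX] := Ftot _ _ FX FY.
      by have [_ _ +] := FP _ FY; apply; first exact: XY Xz.
    by have [_ _ +] := FP _ FX; apply; first exact: Xz; exact: YX.
have Q00 : Q 0 0.
  have [w Qw] := Qtot 0.
  by have := Qlin (-1) _ _ _ _ Qw Qw; rewrite !scaleN1r !addNr.
have A00 : A 0.
  apply: contrapT => nA0.
  have An z : ~ A z.
    by move=> Az; apply: nA0; have := Alin (-1) _ _ Az Az; rewrite scaleN1r addNr.
  apply: (Amax [set 0]).
    by split; [move=> z /An|move=> /(_ 0 erefl) /An].
  split.
  - by move=> _ ->.
  - by move=> a _ _ -> ->; rewrite /= scaler0 addr0.
  - by move=> x v w [_ ->] [_ ->].
have Atot x : exists w, A (x, w).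
  apply: contrapT => nAx; have [w Qw] := Qtot x.
  (* The span of [A] and (x, w). It is still a function: two decompositions of a point with
     different multiples of x would put x into the domain of [A]. *)
  pose B := [set z | exists a u, A u /\ z = a *: (x, w) + u].
  apply: (Amax B).
    split; first by move=> z Az; exists 0, z; rewrite scale0r add0r.
    move=> BA; apply: nAx; exists w; apply: BA.
    by exists 1, 0; rewrite scale1r addr0.
  split.
  - by move=> _ [a [[u v] [Au ->]]]; apply: Qlin => //; exact: (AQ (u, v)).
  - move=> b _ _ [a [u [Au ->]]] [c [v [Av ->]]].
    exists (b * a + c), (b *: u + v); split; first exact: Alin.
    by rewrite scalerDr scalerA scalerDl addrACA.
  - move=> y v1 v2 [a [[u v] [Au [-> ->]]]] [b [[u' v'] [Au' []]]] yE ->.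
    have dE : (a - b) *: x = u' - u.
      rewrite scalerBl; apply/eqP; rewrite subr_eq addrAC eq_sym subr_eq.
      by rewrite yE addrC.
    have Ad : A (u' - u, v' - v).
      have := Alin (-1) _ _ Au Au'; rewrite scaleN1r addrC; exact.
    have [ab|ab] := eqVneq a b.
      move: yE; rewrite ab => /addrI uu'; congr +%R.
      by apply: (Afun u) => //; rewrite uu'.
    exfalso; apply: nAx; exists ((a - b)^-1 *: (v' - v)).
    have := Alin (a - b)^-1 _ _ Ad A00; rewrite addr0.
    rewrite -dE; congr A; rewrite /GRing.scale/= /scale_pair /=; congr pair.
    by rewrite scalerA mulVf ?scale1r// subr_eq0.
pose T x := projT1 (cid (Atot x)).
have AT x : A (x, T x) := projT2 (cid (Atot x)).
have Tlin : linear T.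
  by move=> a x y; apply: (Afun (a *: x + y)) => //; exact: (Alin a (x, T x) (y, T y)).
exists (HB.pack_for {linear V -> W} T (GRing.isLinear.Build _ _ _ _ T Tlin)).
by move=> x; exact: (AQ (x, T x)).
Qed.

(** * Two independent uniform variables from binary digits *)

Definition image_measure d d' (X : measurableType d) (Y : measurableType d')
    (R : realType) (m : {measure set X -> \bar R}) (f : X -> Y)
    (mf : measurable_fun setT f) : {measure set Y -> \bar R} :=
  measure_function_pushforward__canonical__measure_function_Measure m mf.

Section rays.
Context {R : realType}.

(** Upper rays are closed under intersection and generate the Borel sets; finite total mass makes
    the rays from -n an exhaustion by sets of finite measure. *)
Lemma eq_measure_rays (m1 m2 : {measure set (measurableTypeR R) -> \bar R}) :
  (forall a, m1 `]a, +oo[%classic = m2 `]a, +oo[%classic) -> (m1 setT < +oo)%E ->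
  forall A, measurable A -> m1 A = m2 A.
Proof.
move=> m12 m1y; apply: (@measure_unique _ R (measurableTypeR R) (@RGenOInfty.G R)
    (fun n => `](- n%:R)%R, +oo[%classic) _ _ _ _ m1 m2).
- exact: RGenOInfty.measurableE.
- move=> _ _ [a ->] [b ->]; exists (Num.max a b).
  apply/seteqP; split => x /=; rewrite !in_itv/= !andbT gt_max.
    by move=> [-> ->].
  by move=> /andP.
- by move=> n; exists (- n%:R).
- apply/seteqP; split => // x _; exists (Num.truncn `|x|).+1 => //=.
  rewrite in_itv/= andbT ltrNl (le_lt_trans (ler_norm _))// normrN.
  exact: truncnS_gt.
- by move=> _ [a ->].
- move=> n; apply: le_lt_trans m1y; apply: le_measure => //; rewrite inE//=.
Qed.

Lemma lebesgue_measure_affine (a b : R) (A : set R) : 0 < a -> measurable A ->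
  (lebesgue_measure A = a%:E * lebesgue_measure [set r | A (a * r + b)%R])%E.
Proof.
move=> a0 mA.
have mf : measurable_fun setT (fun r : measurableTypeR R =>
    (a * r + b : measurableTypeR R)).
  by apply: measurable_funD => //; apply: measurable_funM.
pose a' : {nonneg R} := NngNum (ltW a0).
rewrite (lebesgue_measure_unique (mu := mscale a' (image_measure lebesgue_measure mf)))//.
move=> _ [[x y]] _ <-; have fE : (fun r => a * r + b) @^-1` `]x, y]%classic = `](x - b) / a, (y - b) / a]%classic.
  apply/seteqP; split => r; rewrite /= !in_itv/= ltr_pdivrMr// ler_pdivlMr//;
  by rewrite ltrBlDr lerBrDr mulrC.
change (lebesgue_measure `]x, y]%classic = a%:E * lebesgue_measure ((fun r => (a * r + b)%R) @^-1` `]x, y]%classic))%E.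
rewrite fE.
rewrite !lebesgue_measure_itv/= !lte_fin ltr_pM2r ?invr_gt0// ltrD2r.
case: ifPn => _; last by rewrite mule0.
by rewrite -!EFinD -EFinM; congr EFin; field; rewrite gt_eqF.
Qed.

Lemma ge0_integral_affine (a b : R) (f : R -> \bar R) : 0 < a ->
  measurable_fun [set: R] f -> (forall r, 0 <= f r)%E ->
  (\int[lebesgue_measure]_r f r =
   a%:E * \int[lebesgue_measure]_r f (a * r + b)%R)%E.
Proof.
move=> a0 mf f0.
have mg : measurable_fun setT (fun r : measurableTypeR R =>
    (a * r + b : measurableTypeR R)).
  by apply: measurable_funD => //; apply: measurable_funM.
pose a' : {nonneg R} := NngNum (ltW a0).
transitivity (\int[mscale a' (image_measure lebesgue_measure mg)]_r f r)%E.
  apply: eq_measure_integral => A mA _.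
  exact: lebesgue_measure_affine.
rewrite ge0_integral_mscale//=; congr (_ * _)%E.
by rewrite (ge0_integral_pushforward mg).
Qed.

End rays.

(** * Self-similarity of the uniform law on [0,1] *)

Section lebesgue01.
Context {R : realType}.
Local Notation P := (lebesgue01 R).

Lemma lebesgue01E A : P A = lebesgue_measure (A `&` `[0, 1]).
Proof. by []. Qed.

Lemma lebesgue01_setT : P setT = 1%E.
Proof.
by rewrite lebesgue01E setTI lebesgue_measure_itv/= lte_fin ltr01 oppr0 adde0.
Qed.

Lemma lebesgue01_halves (A : set R) : measurable A ->
  (P A = 2^-1%:E * (P [set w | A (w / 2)%R] + P [set w | A ((w + 1) / 2)%R]))%E.
Proof.
move=> mA; rewrite !lebesgue01E.
have -> : [set w | A (w / 2)] `&` `[0%R, 1%R] =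
    [set w | (A `&` `[0%R, 2^-1%R]) (2^-1 * w + 0)].
  apply/seteqP; split => w /=; rewrite !in_itv/= addr0 mulrC => -[Aw ?];
    by split => //; lra.
have -> : [set w | A ((w + 1) / 2)] `&` `[0%R, 1%R] =
    [set w | (A `&` `[2^-1%R, 1%R]) (2^-1 * w + 2^-1)].
  apply/seteqP; split => w /=; rewrite !in_itv/= mulrDl mul1r [w / 2]mulrC => -[Aw ?];
    by split => //; lra.
rewrite ge0_muleDr//.
rewrite -!lebesgue_measure_affine//; [|exact: measurableI..].
have -> : `[0%R, 1%R]%classic = `[0%R, 2^-1%R]%classic `|` `]2^-1%R, 1%R]%classic :> set R.
  apply/seteqP; split => x /=; rewrite !in_itv/=.
    by have [?|?] := leP x 2^-1 => /andP[? ?]; [left|right]; lra.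
  by case; lra.
rewrite setIUr measureU//; [|exact: measurableI..|]; last first.
  by rewrite setIACA setIid -subset0 => x [_ /=]; rewrite !in_itv/=; lra.
(* The two closed halves share the point 1/2, which is null. *)
congr (_ + _)%E; have -> : `[2^-1%R, 1%R]%classic = [set 2^-1%R] `|` `]2^-1%R, 1%R]%classic :> set R.
  by rewrite setU1itv// bnd_simp; lra.
rewrite setIUr measureU//; [|exact: measurableI..|]; last first.
  rewrite setIACA setIid -subset0 => x [_ /=]; rewrite !in_itv/= => -[->]; lra.
rewrite -[LHS]add0e; congr (_ + _)%E; apply/esym.
apply: subset_measure0 (lebesgue_measure_set1 2^-1) => //.
exact: measurableI.
Qed.
End lebesgue01.

(** * The numbers formed by the even and by the odd binary digits *)

Section binary_digits.
Context {R : realType}.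
Implicit Types (w : R).

Definition digit w : R := (2^-1 <= w :> R)%:R.
Definition doubling w : R := 2 * w - digit w.
(** Every second digit is read off by doubling twice. Digits are 0 or 1 at every real w, so the sums
    increase within [0,1] and converge everywhere, also outside [0,1]. *)
Fixpoint evenbits_sum n w : R :=
  if n is n'.+1 then (digit w + evenbits_sum n' (doubling (doubling w))) / 2
  else 0.
Definition evenbits w : R := limn (evenbits_sum ^~ w).
Definition oddbits w : R := evenbits (doubling w).

Lemma digit_bounds w : 0 <= digit w <= 1.
Proof. by rewrite /digit ler0n lern1 leq_b1. Qed.

Lemma evenbits_sum_bounds n w : 0 <= evenbits_sum n w <= 1.
Proof.
elim: n w => [|n ih] w /=; first by rewrite lexx ler01.
by have := ih (doubling (doubling w)); have := digit_bounds w; lra.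
Qed.

Lemma evenbits_sum_nondecreasing w : nondecreasing_seq (evenbits_sum ^~ w).
Proof.
apply/nondecreasing_seqP => n; elim: n w => [|n ih] w.
  by have /andP[] := evenbits_sum_bounds 1 w.
have E m : evenbits_sum m.+1 w =
  (digit w + evenbits_sum m (doubling (doubling w))) / 2 by [].
by rewrite (E n) (E n.+1); have := ih (doubling (doubling w)); lra.
Qed.

Lemma cvg_evenbits w : evenbits_sum ^~ w @ \oo --> evenbits w.
Proof.
apply: nondecreasing_is_cvgn; first exact: evenbits_sum_nondecreasing.
by exists 1 => _ [n _ <-]; have /andP[] := evenbits_sum_bounds n w.
Qed.

Lemma evenbits_bounds w : 0 <= evenbits w <= 1.
Proof.
apply/andP; split.
  apply: limr_ge; first by apply: (cvgP (evenbits w)); exact: cvg_evenbits.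
  by near=> n; have /andP[] := evenbits_sum_bounds n w.
apply: limr_le; first by apply: (cvgP (evenbits w)); exact: cvg_evenbits.
by near=> n; have /andP[] := evenbits_sum_bounds n w.
Unshelve. all: by end_near. Qed.

Lemma evenbitsE w : evenbits w = (digit w + oddbits (doubling w)) / 2.
Proof.
apply: cvg_lim => //; rewrite -cvg_shiftS/=.
apply: cvgMl; apply: cvgD; first exact: cvg_cst.
exact: cvg_evenbits.
Qed.

Lemma measurable_digit : measurable_fun setT digit.
Proof.
rewrite (_ : digit = \1_(`[2^-1%R, +oo[%classic : set R)).
  by apply: measurable_indic.
by apply/funext => w; rewrite /digit indicE mem_setE in_itv/= andbT.
Qed.

Lemma measurable_doubling : measurable_fun setT doubling.
Proof.
apply: measurable_funB; last exact: measurable_digit.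
exact: measurable_funM.
Qed.

Lemma measurable_evenbits : measurable_fun setT evenbits.
Proof.
apply: (@measurable_fun_cvg _ _ _ _ (fun n => evenbits_sum n)); last first.
  by move=> w _; exact: cvg_evenbits.
elim=> [|n ih] /=; first exact: measurable_cst.
apply: measurable_funM => //; apply: measurable_funD; first exact: measurable_digit.
apply: measurableT_comp ih _.
by apply: measurableT_comp; exact: measurable_doubling.
Qed.

Lemma measurable_oddbits : measurable_fun setT oddbits.
Proof.
by apply: measurableT_comp; [exact: measurable_evenbits|exact: measurable_doubling].
Qed.

End binary_digits.

(** * Joint law of the two digit halves *)

Section bits_law.
Context {R : realType}.
Local Notation P := (lebesgue01 R).
Implicit Types (w a b : R).

Lemma lebesgue01_fin_num (A : set R) : measurable A -> P A \is a fin_num.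
Proof.
move=> mA; rewrite ge0_fin_numE//; apply: (@le_lt_trans _ _ (P setT)).
  by apply: le_measure; rewrite ?inE.
by rewrite lebesgue01_setT ltry.
Qed.

(** Dropping the endpoint 1 prepares the digit identities on [0,1[: the first digit of w / 2 is 0
    only for w < 1. *)
Lemma lebesgue01_co (A : set R) : measurable A ->
  P A = lebesgue_measure (A `&` `[0, 1[).
Proof.
move=> mA; rewrite lebesgue01E.
have -> : `[0, 1]%classic = `[0, 1[%classic `|` [set 1] :> set R.
  by rewrite setUitv1// bnd_simp.
rewrite setIUr measureU//; [|exact: measurableI..|]; last first.
  rewrite setIACA setIid -subset0 => x [_ /=]; rewrite !in_itv/= => -[] /[swap] ->.
  by rewrite ltxx andbF.
rewrite -[RHS]adde0; congr (_ + _)%E.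
apply: subset_measure0 (lebesgue_measure_set1 1) => //.
exact: measurableI.
Qed.

Lemma lebesgue01_congr (A B : set R) : measurable A -> measurable B ->
  (forall w, 0 <= w < 1 -> A w <-> B w) -> P A = P B.
Proof.
move=> mA mB AB; rewrite !lebesgue01_co//; congr (lebesgue_measure _).
by apply/seteqP; split => w /= [Aw]; rewrite in_itv/= => w01; split => //; apply/AB.
Qed.

Definition tail01 a : R := if a < 0 then 1 else if a < 1 then 1 - a else 0.

Lemma lebesgue01_ray a : P `]a, +oo[%classic = (tail01 a)%:E.
Proof.
rewrite /tail01 lebesgue01E; case: ltP => a0.
  rewrite setIC (_ : _ `&` _ = `[0, 1]%classic); last first.
    by apply/seteqP; split => x /=; rewrite !in_itv/=; lra.
  by rewrite lebesgue_measure_itv/= lte_fin ltr01 oppr0 adde0.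
case: ltP => a1.
  rewrite (_ : _ `&` _ = `]a, 1]%classic); last first.
    by apply/seteqP; split => x /=; rewrite !in_itv/=; lra.
  by rewrite lebesgue_measure_itv/= lte_fin a1.
rewrite (_ : _ `&` _ = set0) ?measure0//.
by rewrite -subset0 => x /=; rewrite !in_itv/=; lra.
Qed.

Lemma tail01_halves a : tail01 a = (tail01 (2 * a) + tail01 (2 * a - 1)) / 2.
Proof. by rewrite /tail01; do ![case: ltP => ?]; lra. Qed.

Lemma evenbits_div2 w : 0 <= w < 1 -> evenbits (w / 2) = oddbits w / 2.
Proof.
move=> w01; rewrite evenbitsE /oddbits /doubling.
rewrite (_ : digit (w / 2) = 0) ?add0r ?subr0 ?(mulrC 2) ?divfK//.
by rewrite /digit leNgt (_ : _ < _)//; lra.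
Qed.

Lemma evenbits_onediv2 w : 0 <= w < 1 ->
  evenbits ((w + 1) / 2) = (1 + oddbits w) / 2.
Proof.
move=> w01; rewrite evenbitsE /oddbits /doubling.
rewrite (_ : digit ((w + 1) / 2) = 1).
  by rewrite (mulrC 2 ((w + 1) / 2)) ?divfK// addrK.
by rewrite /digit (_ : _ <= _)//; lra.
Qed.

Lemma oddbits_div2 w : 0 <= w < 1 -> oddbits (w / 2) = evenbits w.
Proof.
move=> w01; rewrite /oddbits /doubling (_ : digit (w / 2) = 0).
  by rewrite subr0 (mulrC 2) divfK.
by rewrite /digit leNgt (_ : _ < _)//; lra.
Qed.

Lemma oddbits_onediv2 w : 0 <= w < 1 -> oddbits ((w + 1) / 2) = evenbits w.
Proof.
move=> w01; rewrite /oddbits /doubling (_ : digit ((w + 1) / 2) = 1).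
  by rewrite (mulrC 2 ((w + 1) / 2)) divfK// addrK.
by rewrite /digit (_ : _ <= _)//; lra.
Qed.

Definition bits_gt a b : set R := [set w | a < evenbits w /\ b < oddbits w].

Lemma measurable_bits_gt a b : measurable (bits_gt a b).
Proof.
have -> : bits_gt a b = evenbits @^-1` `]a, +oo[ `&` oddbits @^-1` `]b, +oo[.
  by apply/seteqP; split => w /=; rewrite !in_itv/= !andbT.
apply: measurableI.
  by rewrite -[X in measurable X]setTI; apply: measurable_evenbits.
by rewrite -[X in measurable X]setTI; apply: measurable_oddbits.
Qed.

(** Prepending a digit d to w shifts every position by one: the odd digits, preceded by d, become
    the even ones, and the even digits become the odd ones. Hence the thresholds are swapped and
    only one of them is rescaled. *)
Lemma bits_gt_halves a b : P (bits_gt a b) =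
  (2^-1%:E * (P (bits_gt b (2 * a)%R) + P (bits_gt b (2 * a - 1)%R)))%E.
Proof.
rewrite lebesgue01_halves; last exact: measurable_bits_gt.
have mh c : measurable [set w | bits_gt a b ((w + c) / 2)].
  have : measurable_fun setT (fun w : R => (w + c) / 2).
    by apply: measurable_funM => //; apply: measurable_funD.
  move=> /(_ measurableT _ (measurable_bits_gt a b)); rewrite setTI.
  exact.
have mh0 : measurable [set w | bits_gt a b (w / 2)].
  by have := mh 0; under eq_set do rewrite addr0.
congr (_ * (_ + _))%E; apply: lebesgue01_congr => //;
  try exact: measurable_bits_gt; move=> w w01; rewrite /bits_gt/=.
- rewrite evenbits_div2// oddbits_div2//.
  by split=> -[? ?]; split => //; lra.
- rewrite evenbits_onediv2// oddbits_onediv2//.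
  by split=> -[? ?]; split => //; lra.
Qed.

Let phi a b := fine (P (bits_gt a b)).

Let phiE a b : P (bits_gt a b) = (phi a b)%:E.
Proof. by rewrite fineK// lebesgue01_fin_num//; exact: measurable_bits_gt. Qed.

Let phi_halves a b : phi a b = (phi b (2 * a) + phi b (2 * a - 1)) / 2.
Proof.
apply: EFin_inj; rewrite -phiE bits_gt_halves !phiE -EFinD -EFinM.
by rewrite mulrC.
Qed.

Let phi_bounds a b : 0 <= phi a b <= 1.
Proof.
rewrite -!lee_fin -phiE measure_ge0/= -lebesgue01_setT.
by apply: le_measure; rewrite ?inE//; exact: measurable_bits_gt.
Qed.

Let phi1 a b : 1 <= a -> phi a b = 0.
Proof.
move=> a1; rewrite /phi (_ : bits_gt a b = set0) ?measure0//.
by rewrite -subset0 => w [/=]; have := evenbits_bounds w; lra.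
Qed.

Let phi2 a b : 1 <= b -> phi a b = 0.
Proof.
move=> a1; rewrite /phi (_ : bits_gt a b = set0) ?measure0//.
by rewrite -subset0 => w [/=] _; have := evenbits_bounds (doubling w); rewrite /oddbits; lra.
Qed.

(** Both numbers lie in [0,1], so a negative threshold is no condition. With -1 as its standard
    form, [phi a (-1)] is a marginal tail. *)
Let phi_neg1 a b : a < 0 -> phi a b = phi (-1) b.
Proof.
move=> a0; rewrite /phi (_ : bits_gt a b = bits_gt (-1) b)//.
by apply/seteqP; split => w [/= h1 ?]; split => //; have := evenbits_bounds w; lra.
Qed.

Let phi_neg2 a b : b < 0 -> phi a b = phi a (-1).
Proof.
move=> a0; rewrite /phi (_ : bits_gt a b = bits_gt a (-1))//.
apply/seteqP; split => w [/= h1 ?]; split => //;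
  by have := evenbits_bounds (doubling w); rewrite /oddbits; lra.
Qed.

Let phi_neg a b : a < 0 -> b < 0 -> phi a b = 1.
Proof.
move=> a0 b0; apply: EFin_inj; rewrite -phiE -lebesgue01_setT; congr (P _).
apply/seteqP; split => // w _; split.
  by have := evenbits_bounds w; lra.
by have := evenbits_bounds (doubling w); rewrite /oddbits; lra.
Qed.

Lemma eq0_geometric_bound (x : R) : (forall n, `|x| <= 2^-1 ^+ n) -> x = 0.
Proof.
move=> xn; apply/eqP; apply: contrapT => /negP x0.
have {}x0 : 0 < `|x| by rewrite normr_gt0.
set n := (Num.truncn `|x|^-1).+1.
have : `|x|^-1 < 2 ^+ n.
  apply: lt_trans (truncnS_gt _) _; rewrite -/n -natrX ltr_nat.
  exact: ltn_expl.
by rewrite ltNge -[leLHS]invrK -exprVn lef_pV2 ?posrE ?exprn_gt0 ?invr_gt0// xn.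
Qed.

Let phi_sym a : phi (-1) a = phi a (-1).
Proof.
rewrite phi_halves.
have -> : phi a (2 * -1) = phi a (-1) by apply: phi_neg2; lra.
have -> : phi a (2 * -1 - 1) = phi a (-1) by apply: phi_neg2; lra.
by field.
Qed.

(** Both sides solve the same halving equation. For 0 <= a < 1 one of its two terms is known
    exactly, so each use halves a discrepancy that is at most 1 to begin with. *)
Let phi_marginal a : phi a (-1) = tail01 a.
Proof.
have rec c : phi c (-1) = (phi (2 * c) (-1) + phi (2 * c - 1) (-1)) / 2.
  by rewrite phi_halves !phi_sym.
apply/eqP; rewrite -subr_eq0; apply/eqP/eq0_geometric_bound => n.
elim: n a => [|n ih] a.
  have := phi_bounds a (-1); rewrite expr0 ler_norml /tail01.
  by do ![case: ltP => ?]; lra.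
have [a0|a0] := ltP a 0.
  by rewrite phi_neg// /tail01 a0 subrr normr0 exprn_ge0.
have [a1|a1] := ltP a 1; last first.
  by rewrite phi1// /tail01 ltNge a0/= ltNge a1/= subrr normr0 exprn_ge0.
rewrite rec tail01_halves exprS.
have [a2|a2] := ltP a 2^-1.
  rewrite (@phi_neg (2 * a - 1) _); [|lra..].
  have -> : tail01 (2 * a - 1) = 1 by rewrite /tail01; case: ltP => ?; lra.
  by have := ih (2 * a); rewrite !ler_norml; lra.
rewrite (@phi1 (2 * a) _); last lra.
have -> : tail01 (2 * a) = 0 by rewrite /tail01; do ![case: ltP => ?]; lra.
by have := ih (2 * a - 1); rewrite !ler_norml; lra.
Qed.

Let phi_marginal2 a : phi (-1) a = tail01 a.
Proof. by rewrite phi_sym phi_marginal. Qed.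

Let tail01_bounds a : 0 <= tail01 a <= 1.
Proof. by rewrite /tail01; do ![case: ltP => ?]; lra. Qed.

(** The same contraction, with the bound for all pairs at once because halving swaps the arguments.
    The known term is a marginal for a < 1/2 and 0 otherwise. *)
Let phi_prod a b : phi a b = tail01 a * tail01 b.
Proof.
apply/eqP; rewrite -subr_eq0; apply/eqP/eq0_geometric_bound => n.
elim: n a b => [|n ih] a b.
  have := phi_bounds a b; rewrite expr0 ler_norml.
  by have := tail01_bounds a; have := tail01_bounds b; nra.
have [a0|a0] := ltP a 0.
  by rewrite phi_neg1// phi_marginal2 /tail01 a0 mul1r subrr normr0 exprn_ge0.
have [a1|a1] := ltP a 1; last first.
  by rewrite phi1// /tail01 (ltNge a) a0/= ltNge a1/= mul0r subrr normr0 exprn_ge0.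
rewrite phi_halves (tail01_halves a) exprS.
have [a2|a2] := ltP a 2^-1.
  rewrite (@phi_neg2 _ (2 * a - 1)); last lra.
  have -> : tail01 (2 * a - 1) = 1 by rewrite /tail01; case: ltP => ?; lra.
  by rewrite phi_marginal; have := ih b (2 * a); rewrite !ler_norml; lra.
rewrite (@phi2 _ (2 * a)); last lra.
have -> : tail01 (2 * a) = 0 by rewrite /tail01; do ![case: ltP => ?]; lra.
by have := ih b (2 * a - 1); rewrite !ler_norml; lra.
Qed.

Lemma lebesgue01_bits_gt a b :
  P (bits_gt a b) = (P `]a, +oo[%classic * P `]b, +oo[%classic)%E.
Proof. by rewrite phiE phi_prod !lebesgue01_ray. Qed.


End bits_law.

Section bits_law2.
Context {R : realType}.
Local Notation P := (lebesgue01 R).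
Implicit Types (w a b : R).
(** Two rounds of [eq_measure_rays]: for a fixed ray on the Y side both members are finite measures
    in A; then, for fixed A, they are finite measures in B. *)
Lemma independent_rays (X Y : R -> R) :
  measurable_fun setT (X : measurableTypeR R -> measurableTypeR R) ->
  measurable_fun setT (Y : measurableTypeR R -> measurableTypeR R) ->
  (forall a b, P [set w | a < X w /\ b < Y w] =
               (P `]a, +oo[%classic * P `]b, +oo[%classic)%E) ->
  forall A B : set R, measurable A -> measurable B ->
  P [set w | A (X w) /\ B (Y w)] = (P A * P B)%E.
Proof.
move=> mX mY XY A B mA mB.
pose nn (C : set R) : {nonneg R} := NngNum (fine_ge0 (measure_ge0 P C)).
have nnE (C : set R) : measurable C -> (nn C)%:num%:E = P C.
  by move=> mC; rewrite fineK// lebesgue01_fin_num.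
have mpre (Z : measurableTypeR R -> measurableTypeR R)
    (C : set (measurableTypeR R)) :
    measurable_fun setT Z -> measurable C -> measurable (Z @^-1` C).
  by move=> mZ mC; rewrite -[X in measurable X]setTI; exact: mZ.
have XB b : P [set w | A (X w) /\ b < Y w] = (P A * P `]b, +oo[%classic)%E.
  have mYb := mpre _ _ mY (measurable_itv `]b, +oo[).
  have imE (C : set R) : image_measure (mrestr P mYb) mX C =
      P [set w | C (X w) /\ b < Y w].
    rewrite -[LHS]/(P (X @^-1` C `&` Y @^-1` `]b, +oo[%classic)).
    by congr (P _); apply/seteqP; split => w /=; rewrite in_itv/= andbT.
  have scE (C : set R) : mscale (nn `]b, +oo[%classic) P C =
      (P C * P `]b, +oo[%classic)%E.
    by rewrite -[LHS]/((nn _)%:num%:E * P C)%E nnE// muleC.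
  rewrite -imE -scE; apply: (@eq_measure_rays R (image_measure (mrestr P mYb) mX)
    (mscale (nn `]b, +oo[%classic) P)) => //; last first.
    rewrite imE -ge0_fin_numE//; apply: lebesgue01_fin_num.
    rewrite (_ : [set _ | _] = Y @^-1` `]b, +oo[%classic)//.
    by apply/seteqP; split => w /=; rewrite in_itv/= andbT => //; case.
  move=> a; rewrite imE [RHS](scE _) -XY; congr (P _).
  by apply/seteqP; split => w /=; rewrite in_itv/= andbT.
have mXA := mpre _ _ mX mA.
have imE (C : set R) : image_measure (mrestr P mXA) mY C =
    P [set w | A (X w) /\ C (Y w)].
  rewrite -[LHS]/(P (Y @^-1` C `&` X @^-1` A)).
  by congr (P _); apply/seteqP; split => w /= -[].
have scE (C : set R) : mscale (nn A) P C = (P A * P C)%E.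
  by rewrite -[LHS]/((nn A)%:num%:E * P C)%E nnE.
rewrite -imE -scE; apply: (@eq_measure_rays R (image_measure (mrestr P mXA) mY)
  (mscale (nn A) P)) => //; last first.
  rewrite imE -ge0_fin_numE//; apply: lebesgue01_fin_num.
  rewrite (_ : [set _ | _] = X @^-1` A)//.
  by apply/seteqP; split => w /=; [case|split].
move=> b; rewrite imE [RHS](scE _) -XB; congr (P _).
by apply/seteqP; split => w /=; rewrite in_itv/= andbT.
Qed.

Lemma lebesgue01_bits (A B : set R) : measurable A -> measurable B ->
  P [set w | A (evenbits w) /\ B (oddbits w)] = (P A * P B)%E.
Proof.
apply: independent_rays; [exact: measurable_evenbits|exact: measurable_oddbits|].
exact: lebesgue01_bits_gt.
Qed.

End bits_law2.

(** * Poisson fields over a sequence of independent variables *)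

Section iid.
Context {R : realType}.
Local Notation W := (measurableTypeR R).

Definition uniform01 : probability W R :=
  HB.pack_for (probability W R) (lebesgue01 R : set W -> \bar R)
    (Measure.class (lebesgue01 R))
    (Measure_isProbability.Build _ W R (lebesgue01 R) lebesgue01_setT).
Local Notation P := uniform01.

Definition even_bits : W -> W := evenbits.
Definition odd_bits : W -> W := oddbits.

Lemma measurable_even_bits : measurable_fun setT even_bits.
Proof. exact: measurable_evenbits. Qed.

Lemma measurable_odd_bits : measurable_fun setT odd_bits.
Proof. exact: measurable_oddbits. Qed.

Lemma ge0_integral_bits (F : W * W -> \bar R) : measurable_fun setT F ->
  (forall z, 0 <= F z)%E ->
  (\int[P]_w F (even_bits w, odd_bits w) = \int[P]_u \int[P]_v F (u, v))%E.
Proof.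
move=> mF F0.
have mb : measurable_fun setT (fun w => (even_bits w, odd_bits w)).
  by apply: measurable_fun_pair; [exact: measurable_even_bits|exact: measurable_odd_bits].
rewrite -(@fubini_tonelli1 _ _ W W R P P F mF F0).
transitivity (\int[image_measure P mb]_z F z)%E.
  by rewrite (ge0_integral_pushforward mb).
apply: eq_measure_integral => A mA _; apply/esym.
apply: (@product_measure_unique _ _ W W R P P (image_measure P mb)) => //.
by move=> B C mB mC; exact: lebesgue01_bits.
Qed.

(** Each odd half is split again, so that a single uniform number carries an infinite independent
    sequence. *)
Definition bit_stream n w : W := even_bits (iter n odd_bits w).

Lemma measurable_bit_stream n : measurable_fun setT (bit_stream n).
Proof.
apply: measurableT_comp; first exact: measurable_even_bits.
elim: n => [|n ih] /=; first exact: measurable_id.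
by apply: measurableT_comp => //; exact: measurable_odd_bits.
Qed.

(** Independence, phrased as factorisation of expectations. The induction takes variable 0 from the
    even digits and the remaining stream from the odd ones. *)
Lemma bit_stream_iid N (g : nat -> W -> R) (e : nat -> R) :
  (forall n, measurable_fun setT (g n)) -> (forall n w, 0 <= g n w) ->
  (forall n, \int[P]_w (g n w)%:E = (e n)%:E)%E ->
  (\int[P]_w (\prod_(n < N) g n (bit_stream n w))%:E = (\prod_(n < N) e n)%:E)%E.
Proof.
elim: N g e => [|N ih] g e mg g0 ge.
  under eq_integral do rewrite big_ord0.
  by rewrite big_ord0 integral_cst// mul1e; exact: lebesgue01_setT.
pose F (z : W * W) := (g 0%N z.1 * \prod_(n < N) g n.+1 (bit_stream n z.2))%:E.
have mprod : measurable_fun setT (fun w => \prod_(n < N) g n.+1 (bit_stream n w)).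
  apply: measurable_prod => n _.
  by apply: measurableT_comp => //; exact: measurable_bit_stream.
transitivity (\int[P]_w F (even_bits w, odd_bits w))%E.
  apply: eq_integral => w _; rewrite /F big_ord_recl/=; congr (_ * _)%:E.
  by apply: eq_bigr => i _; rewrite /bit_stream /= -iterSr.
rewrite ge0_integral_bits; last 2 first.
- apply/measurable_EFinP; apply: measurable_funM.
    by apply: measurableT_comp => //; exact: measurable_fst.
  by apply: (measurableT_comp mprod); exact: measurable_snd.
- by move=> z; rewrite lee_fin mulr_ge0// prodr_ge0.
rewrite big_ord_recl EFinM -(ih _ _ (fun n => mg n.+1) (fun n => g0 n.+1) (fun n => ge n.+1)).
rewrite -ge muleC -ge0_integralZl//; last 3 first.
- exact/measurable_EFinP.
- by move=> w _; rewrite lee_fin.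
- by apply: integral_ge0 => w _; rewrite lee_fin prodr_ge0.
apply: eq_integral => u _; rewrite muleC -ge0_integralZl//.
- exact/measurable_EFinP.
- by move=> w _; rewrite lee_fin prodr_ge0.
- by rewrite lee_fin.
Qed.

End iid.

(** * Truncated Poisson counts *)

Section poisson.
Context {R : realType}.
Local Notation W := (measurableTypeR R).
Local Notation P := (@uniform01 R).
Implicit Types q : R.

(** The generating function of the Poisson(1) law summed over j < n. Thus [poisson_cdf n] is the
    probability of N < n, with strict inequality, and N > i corresponds to the threshold
    [poisson_cdf i.+1]. *)
Definition poisson_pgf q n : R := expR (-1) * series (exp_coeff q) n.
Definition poisson_cdf n : R := poisson_pgf 1 n.

Lemma poisson_pgfS q n : poisson_pgf q n.+1 =
  poisson_pgf q n + expR (-1) * (q ^+ n / n`!%:R).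
Proof. by rewrite /poisson_pgf /series/= big_nat_recr//= mulrDr. Qed.

Lemma poisson_cdfS n :
  poisson_cdf n.+1 = poisson_cdf n + expR (-1) / n`!%:R.
Proof. by rewrite /poisson_cdf poisson_pgfS expr1n div1r. Qed.

Lemma cvg_poisson_pgf q : poisson_pgf q @ \oo --> expR (q - 1).
Proof.
rewrite addrC expRD; apply: cvgMr; exact: is_cvg_series_exp_coeff.
Qed.

Lemma cvg_poisson_cdf : poisson_cdf @ \oo --> (1 : R).
Proof. by have := @cvg_poisson_pgf 1; rewrite subrr expR0. Qed.

Lemma poisson_cdf_nondecreasing : nondecreasing_seq poisson_cdf.
Proof.
apply/nondecreasing_seqP => n; rewrite poisson_cdfS lerDl.
by rewrite divr_ge0// expR_ge0.
Qed.

Lemma poisson_cdf_bounds n : 0 <= poisson_cdf n <= 1.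
Proof.
apply/andP; split.
  have <- : poisson_cdf 0 = 0.
    by rewrite /poisson_cdf /poisson_pgf /series/= big_geq// mulr0.
  exact: poisson_cdf_nondecreasing.
have <- : limn poisson_cdf = 1 by apply: cvg_lim => //; exact: cvg_poisson_cdf.
apply: nondecreasing_cvgn_le; first exact: poisson_cdf_nondecreasing.
by apply: (cvgP (1 : R)); exact: cvg_poisson_cdf.
Qed.

(* probability generating function of the truncated Poisson variable [minn N n] *)
Definition trunc_pgf q n : R := poisson_pgf q n + (1 - poisson_cdf n) * q ^+ n.

(** Raising the truncation level from n to n + 1 matters only on the event N > n, where q^n becomes
    q^(n+1). *)
Lemma trunc_pgfS q n : trunc_pgf q n =
  trunc_pgf q n.+1 + (1 - q) * q ^+ n * (1 - poisson_cdf n.+1).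
Proof. rewrite /trunc_pgf poisson_pgfS poisson_cdfS exprS; ring. Qed.

Lemma cvg_trunc_pgf q : 0 <= q <= 1 -> trunc_pgf q @ \oo --> expR (q - 1).
Proof.
move=> /andP[q0 q1]; rewrite -[expR _]addr0; apply: cvgD.
  exact: cvg_poisson_pgf.
apply: (@squeeze_cvgr _ _ _ _ (cst 0) (fun n => 1 - poisson_cdf n)).
- near=> n; have := poisson_cdf_bounds n => /andP[? ?].
  rewrite mulr_ge0 ?subr_ge0 ?exprn_ge0//=.
  by rewrite ler_piMr ?subr_ge0// exprn_ile1.
- exact: cvg_cst.
- rewrite -(subrr (1 : R)); apply: cvgB; first exact: cvg_cst.
  exact: cvg_poisson_cdf.
Unshelve. all: by end_near. Qed.

Lemma trunc_pgf_nonincreasing q : 0 <= q <= 1 -> nonincreasing_seq (trunc_pgf q).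
Proof.
move=> /andP[q0 q1]; apply/nonincreasing_seqP => m; rewrite [leRHS]trunc_pgfS lerDl.
have /andP[? ?] := poisson_cdf_bounds m.+1.
by rewrite !mulr_ge0 ?subr_ge0// exprn_ge0.
Qed.

Lemma trunc_pgf_le1 q n : 0 <= q <= 1 -> trunc_pgf q n <= 1.
Proof.
move=> q01; have <- : trunc_pgf q 0 = 1.
  rewrite /trunc_pgf /poisson_cdf /poisson_pgf /series/= !big_geq//.
  by rewrite !mulr0 add0r subr0 mulr1.
exact: trunc_pgf_nonincreasing.
Qed.

Lemma trunc_pgf_ge q n : 0 <= q <= 1 -> expR (q - 1) <= trunc_pgf q n.
Proof.
move=> q01; have <- : limn (trunc_pgf q) = expR (q - 1).
  by apply: cvg_lim => //; exact: cvg_trunc_pgf.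
apply: nonincreasing_cvgn_ge; first exact: trunc_pgf_nonincreasing.
by apply: (cvgP (expR (q - 1))); exact: cvg_trunc_pgf.
Qed.

Lemma trunc_pgf_ge0 q n : 0 <= q <= 1 -> 0 <= trunc_pgf q n.
Proof. by move=> /(trunc_pgf_ge n); apply: le_trans; exact: expR_ge0. Qed.

Lemma uniform01_ge (a : R) : 0 <= a <= 1 ->
  P [set w : W | a <= (w : R)] = (1 - a)%:E.
Proof.
move=> a01; rewrite -[LHS]/(lebesgue_measure ([set w : R | a <= w] `&` `[0, 1])).
rewrite (_ : _ `&` _ = `[a, 1]%classic).
  rewrite lebesgue_measure_itv/= lte_fin; case: ltP => //.
  by move=> ?; congr EFin; lra.
by apply/seteqP; split => x /=; rewrite !in_itv/=; lra.
Qed.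

Lemma measurable_ray (a : R) : measurable [set w : W | a <= (w : R)].
Proof. by rewrite -set_itvcy; exact: measurable_itv. Qed.

(** With N the Poisson quantile of w, threshold i + 1 is passed exactly when N > i, so the product
    is q^min(N, n). *)
Lemma integral_trunc_pgf q n : 0 <= q <= 1 ->
  (\int[P]_w (\prod_(i < n) (if poisson_cdf i.+1 <= (w : R) then q else 1))%:E =
   (trunc_pgf q n)%:E)%E.
Proof.
move=> /andP[q0 q1]; elim: n => [|n ih].
  under eq_integral do rewrite big_ord0.
  rewrite integral_cst// mul1e /trunc_pgf /poisson_cdf /poisson_pgf/= /series/=.
  by rewrite !big_geq// !mulr0 add0r subr0 mulr1; exact: lebesgue01_setT.
pose G m (w : W) := \prod_(i < m) (if poisson_cdf i.+1 <= (w : R) then q else 1).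
have G0 m w : 0 <= G m w by apply: prodr_ge0 => i _; case: ifP.
have mG m : measurable_fun setT (G m).
  apply: measurable_prod => i _; apply: measurable_fun_ifT => //.
  apply: (measurable_fun_bool true); rewrite setTI.
  exact: (measurable_ray (poisson_cdf i.+1)).
pose A := [set w : W | poisson_cdf n.+1 <= (w : R)].
have mA : measurable A by exact: measurable_ray.
pose k := (1 - q) * q ^+ n.
have k0 : 0 <= k by rewrite mulr_ge0 ?subr_ge0 ?exprn_ge0.
(* The thresholds increase, so passing number n + 1 forces all n factors of [G n] to be q; the next
   factor then removes [k]. *)
have GS w : G n w = G n.+1 w + k * \1_A w.
  rewrite /G big_ord_recr/= indicE; case: ifPn => nw.
    rewrite mem_set//= mulr1 /k.
    have -> : \prod_(i < n) (if poisson_cdf i.+1 <= (w : R) then q else 1) = q ^+ n.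
      transitivity (\prod_(i < n) q); last by rewrite prodr_const card_ord.
      apply: eq_bigr => i _; case: ifPn => // /negP[].
      apply: (@le_trans _ R (poisson_cdf n.+1)) => //.
      by apply: poisson_cdf_nondecreasing; rewrite ltnS ltnW.
    ring.
  by rewrite memNset ?mulr1 ?mulr0 ?addr0//; exact/negP.
have : (\int[P]_w (G n w)%:E =
    \int[P]_w (G n.+1 w)%:E + (k * (1 - poisson_cdf n.+1))%:E)%E.
  under eq_integral do rewrite GS EFinD.
  rewrite ge0_integralD//; [|by move=> w _; rewrite lee_fin|exact/measurable_EFinP
    |by move=> w _; rewrite lee_fin mulr_ge0|
     apply/measurable_EFinP; apply: measurable_funM => //; exact: measurable_indic].
  congr (_ + _)%E; under eq_integral do rewrite EFinM.
  rewrite ge0_integralZl//; last first.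
    by apply/measurable_EFinP; exact: measurable_indic.
  rewrite integral_indic// setIT [RHS]EFinM; congr (_ * _)%E.
  by apply: uniform01_ge; exact: poisson_cdf_bounds.
rewrite ih (trunc_pgfS q n) -/k -/(G n.+1).
case: (\int[P]_w (G n.+1 w)%:E)%E => [r| |] //= [] /addIr ->.
by [].
Qed.

End poisson.

(** * The marked Poisson field and its truncated Laplace functional *)

Section poisson_field.
Context {R : realType}.
Local Notation W := (measurableTypeR R).
Local Notation P := (@uniform01 R).

(** The k-th variable of the stream serves shell k: its even digits are the quantile that fixes the
    number of points, its odd digits a fresh stream of marks. Each mark will be split once more,
    into a position and a fractional radius. *)
Definition occurs k i (w : W) : bool :=
  poisson_cdf i.+1 <= (even_bits (bit_stream k w) : R).
Definition mark k i (w : W) : W :=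
  bit_stream i (odd_bits (bit_stream k w)).

Lemma measurable_poisson_ge i :
  measurable_fun setT (fun w : W => poisson_cdf i.+1 <= (w : R)).
Proof.
apply: (measurable_fun_bool true); rewrite setTI.
exact: (measurable_ray (poisson_cdf i.+1)).
Qed.

Lemma measurable_occurs k i : measurable_fun setT (occurs k i).
Proof.
apply: (measurableT_comp (measurable_poisson_ge i)).
apply: measurableT_comp; [exact: measurable_even_bits|exact: measurable_bit_stream].
Qed.

Lemma measurable_mark k i : measurable_fun setT (mark k i).
Proof.
apply: measurableT_comp; first exact: measurable_bit_stream.
apply: measurableT_comp; first exact: measurable_odd_bits.
exact: measurable_bit_stream.
Qed.

(** Conditionally on the count, the marks are independent and every point present contributes its
    mean q, which leaves the generating function of the truncated count. *)
Lemma integral_shell n (phi : W -> R) (q : R) :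
  measurable_fun setT phi -> (forall w, 0 <= phi w) -> 0 <= q <= 1 ->
  (\int[P]_w (phi w)%:E = q%:E)%E ->
  (\int[P]_w (\prod_(i < n) if poisson_cdf i.+1 <= (even_bits w : R)
      then phi (bit_stream i (odd_bits w)) else 1)%:E = (trunc_pgf q n)%:E)%E.
Proof.
move=> mphi phi0 q01 phiq.
pose F (z : W * W) := (\prod_(i < n) if poisson_cdf i.+1 <= (z.1 : R)
      then phi (bit_stream i z.2) else 1)%:E.
rewrite -[LHS]/(\int[P]_w F (even_bits w, odd_bits w))%E ge0_integral_bits.
- rewrite -(integral_trunc_pgf n q01); apply: eq_integral => u _; rewrite /F/=.
  apply: (bit_stream_iid n (g := fun i w => if poisson_cdf i.+1 <= (u : R)
      then phi w else 1) (e := fun i => if poisson_cdf i.+1 <= (u : R) then q else 1)).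
  + by move=> i; case: (poisson_cdf i.+1 <= (u : R)).
  + by move=> i w; case: (poisson_cdf i.+1 <= (u : R)).
  + move=> i; case: (poisson_cdf i.+1 <= (u : R)) => //; rewrite integral_cst// mul1e; exact: lebesgue01_setT.
- apply/measurable_EFinP; apply: measurable_prod => i _.
  apply: measurable_fun_ifT => //.
    exact: (measurableT_comp (measurable_poisson_ge i) measurable_fst).
  apply: measurableT_comp => //; apply: measurableT_comp; first exact: measurable_bit_stream.
  exact: measurable_snd.
- by move=> z; rewrite lee_fin prodr_ge0// => i _; case: ifP.
Qed.

Lemma integral_field K n (phi : nat -> W -> R) (q : nat -> R) :
  (forall k, measurable_fun setT (phi k)) -> (forall k w, 0 <= phi k w) ->
  (forall k, 0 <= q k <= 1) -> (forall k, \int[P]_w (phi k w)%:E = (q k)%:E)%E ->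
  (\int[P]_w (\prod_(k < K) \prod_(i < n)
      if occurs k i w then phi k (mark k i w) else 1)%:E =
   (\prod_(k < K) trunc_pgf (q k) n)%:E)%E.
Proof.
move=> mphi phi0 q01 phiq.
apply: (bit_stream_iid K (g := fun k w => \prod_(i < n)
   if poisson_cdf i.+1 <= (even_bits w : R)
      then phi k (bit_stream i (odd_bits w)) else 1)
   (e := fun k => trunc_pgf (q k) n)).
- move=> k; apply: measurable_prod => i _.
  apply: measurable_fun_ifT => //; first
    exact: (measurableT_comp (measurable_poisson_ge i) measurable_even_bits).
  apply: (measurableT_comp (mphi k)).
  exact: (measurableT_comp (measurable_bit_stream i) measurable_odd_bits).
- by move=> k w; apply: prodr_ge0 => i _; case: ifP.
- by move=> k; exact: integral_shell.
Qed.

Definition field_energy (h : nat -> W -> R) K n w : R :=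
  \sum_(k < K) \sum_(i < n) if occurs k i w then h k (mark k i w) else 0.

Lemma expR_mean_bounds (h : W -> R) (q : R) :
  measurable_fun setT h -> (forall w, 0 <= h w) ->
  (\int[P]_w (expR (- h w))%:E = q%:E)%E -> 0 <= q <= 1.
Proof.
move=> mh h0 hq.
rewrite -!lee_fin -hq; apply/andP; split.
  by apply: integral_ge0 => w _; rewrite lee_fin expR_ge0.
have I1 : (\int[P]_w (1 : R)%:E = 1)%E.
  by rewrite integral_cst// mul1e; exact: lebesgue01_setT.
suff : (\int[P]_w (expR (- h w))%:E <= \int[P]_w (1 : R)%:E)%E by rewrite I1.
apply: ge0_le_integral => //.
- by apply/measurable_EFinP; apply: measurableT_comp => //; apply: measurableT_comp.
- by move=> w _; rewrite lee_fin -[leRHS]expR0 ler_expR oppr_le0.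
Qed.

Lemma integral_expR_field (h : nat -> W -> R) K n (q : nat -> R) :
  (forall k, measurable_fun setT (h k)) -> (forall k w, 0 <= h k w) ->
  (forall k, \int[P]_w (expR (- h k w))%:E = (q k)%:E)%E ->
  (\int[P]_w (expR (- field_energy h K n w))%:E =
    (\prod_(k < K) trunc_pgf (q k) n)%:E)%E.
Proof.
move=> mh h0 hq.
have mphi k : measurable_fun setT (fun w => expR (- h k w)).
  by apply: measurableT_comp => //; apply: measurableT_comp.
rewrite -(integral_field K n mphi (fun k w => expR_ge0 _) _ hq).
  apply: eq_integral => w _; rewrite /field_energy -sumrN expR_sum; congr EFin.
  apply: eq_bigr => k _; rewrite -sumrN expR_sum; apply: eq_bigr => i _.
  by case: ifP => // _; rewrite oppr0 expR0.
by move=> k; exact: (expR_mean_bounds (mh k) (h0 k) (hq k)).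
Qed.
End poisson_field.

(** * Removal of the truncation *)

Section field_limit.
Context {R : realType}.
Local Notation W := (measurableTypeR R).
Local Notation P := (@uniform01 R).

(** The number of shells and the truncation level grow together. From below, each factor is at least
    exp(q k - 1). From above, factors are at most 1 and may be dropped: the first K of them bound
    the product and converge, and then K tends to infinity. *)
Lemma cvg_prod_trunc_pgf (q : nat -> R) (S : R) :
  (forall k, 0 <= q k <= 1) -> series (fun k => 1 - q k) @ \oo --> S ->
  (fun n => \prod_(k < n) trunc_pgf (q k) n) @ \oo --> expR (- S).
Proof.
move=> q01 qS; set u := (fun n => _).
have t0 k n : 0 <= trunc_pgf (q k) n by apply: trunc_pgf_ge0.
have le_u K n : (K <= n)%N -> u n <= \prod_(k < K) trunc_pgf (q k) n.
  move=> Kn; rewrite /u -!(big_mkord xpredT (fun k => trunc_pgf (q k) n)).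
  rewrite (big_cat_nat _ Kn)//=; apply: ler_piMr; first exact: prodr_ge0.
  by apply: prodr_ile1 => k _; rewrite t0 trunc_pgf_le1.
have nu : nonincreasing_seq u.
  apply/nonincreasing_seqP => n; apply: le_trans (le_u n n.+1 (leqnSn n)) _.
  apply: ler_prod => k _; rewrite t0/=.
  by apply: trunc_pgf_nonincreasing.
have u0 n : 0 <= u n by exact: prodr_ge0.
have cu : cvgn u by apply: nonincreasing_is_cvgn => //; exists 0 => _ [n _ <-].
have prodE K : \prod_(k < K) expR (q k - 1) = expR (- series (fun k => 1 - q k) K).
  rewrite /series/= big_mkord -sumrN expR_sum.
  by apply: eq_bigr => k _; rewrite opprB.
have cE : (fun K => expR (- series (fun k => 1 - q k) K)) @ \oo --> expR (- S).
  by apply: continuous_cvg; [exact: continuous_expR|exact: cvgN].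
suff -> : expR (- S) = limn u by [].
apply/eqP; rewrite eq_le; apply/andP; split.
  apply: limr_ge => //; near=> n.
  apply: (@le_trans _ _ (\prod_(k < n) expR (q k - 1))); last first.
    by apply: ler_prod => k _; rewrite expR_ge0 trunc_pgf_ge.
  rewrite prodE ler_expR lerN2.
  have <- : limn (series (fun k => 1 - q k)) = S by exact: cvg_lim.
  apply: nondecreasing_cvgn_le; last by apply: (cvgP S).
  apply/nondecreasing_seqP => m; rewrite /series/= big_nat_recr//= lerDl.
  by have /andP[_] := q01 m; rewrite subr_ge0.
have <- : limn (fun K => expR (- series (fun k => 1 - q k) K)) = expR (- S).
  exact: cvg_lim.
apply: limr_ge; first by apply: (cvgP (expR (- S))).
near=> K; rewrite -prodE.
have cK : (fun n => \prod_(k < K) trunc_pgf (q k) n) @ \oo -->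
    \prod_(k < K) expR (q k - 1).
  elim: (K : nat) => [|m ih].
    rewrite big_ord0 (_ : (fun _ => _) = cst 1) ; first exact: cvg_cst.
    by apply/funext => n; rewrite big_ord0.
  rewrite big_ord_recr/= (_ : (fun _ => _) =
    (fun n => (\prod_(k < m) trunc_pgf (q k) n) * trunc_pgf (q m) n)).
    by apply: cvgM => //; exact: cvg_trunc_pgf.
  by apply/funext => n; rewrite big_ord_recr.
rewrite -(cvg_lim _ cK)//; apply: ler_lim => //; first exact: (cvgP _ cK).
by near=> n; apply: le_u; near: n; exact: nbhs_infty_ge.
Unshelve. all: by end_near. Qed.

Lemma cvg_integral_expR_field (h : nat -> W -> R) (q : nat -> R) (S : R) :
  (forall k, measurable_fun setT (h k)) -> (forall k w, 0 <= h k w) ->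
  (forall k, \int[P]_w (expR (- h k w))%:E = (q k)%:E)%E ->
  series (fun k => 1 - q k) @ \oo --> S ->
  ((fun n => \int[P]_w (expR (- field_energy h n n w))%:E) @ \oo -->
    (expR (- S))%:E)%E.
Proof.
move=> mh h0 hq qS.
have q01 k : 0 <= q k <= 1 by exact: (expR_mean_bounds (mh k) (h0 k) (hq k)).
rewrite (_ : (fun _ => _) = (fun n => (\prod_(k < n) trunc_pgf (q k) n)%:E)).
  apply/fine_cvgP; split; first by near=> n.
  exact: cvg_prod_trunc_pgf.
by apply/funext => n; exact: integral_expR_field.
Unshelve. all: by end_near. Qed.
End field_limit.

(** * The jump intensity *)

Section kernel_integral.
Context {R : realType}.
Local Notation W := (measurableTypeR R).
Local Notation P := (@uniform01 R).
Local Notation mu := (@lebesgue_measure R).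

Lemma measurable_inv : measurable_fun setT (@GRing.inv R).
Proof.
rewrite (_ : setT = [set 0] `|` ~` [set 0 : R]); last by rewrite setUv.
apply/measurable_funU => //; [exact: measurableC|split].
  exact: measurable_fun_set1.
apply: open_continuous_measurable_fun; first exact/closed_openC.
by move=> x /set_mem/eqP x0; exact: inv_continuous.
Qed.

(** The integrand of the exponential formula. At r = 0 the convention 1/0 = 0 gives it the value 0,
    on a null set. *)
Definition jump_loss (c r : R) : R := 1 - expR (- (c / r) ^+ 2).

Lemma jump_loss_ge0 c r : 0 <= jump_loss c r.
Proof. by rewrite subr_ge0 -[leRHS]expR0 ler_expR oppr_le0 sqr_ge0. Qed.

Lemma jump_loss0 r : jump_loss 0 r = 0.
Proof. by rewrite /jump_loss mul0r expr0n/= oppr0 expR0 subrr. Qed.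

Lemma jump_loss_norm c r : jump_loss `|c| r = jump_loss c r.
Proof. by rewrite /jump_loss !exprMn -normrX ger0_norm ?sqr_ge0. Qed.

Lemma measurable_jump_loss (d : measure_display) (T : measurableType d)
    (f g : T -> R) : measurable_fun setT f -> measurable_fun setT g ->
  measurable_fun setT (fun x => jump_loss (f x) (g x)).
Proof.
move=> mf mg; apply: measurable_funB => //.
apply: measurableT_comp => //; apply: measurableT_comp => //.
apply: measurable_funX; apply: measurable_funM => //.
exact: (measurableT_comp measurable_inv).
Qed.

Definition jump_rate : \bar R := (\int[mu]_(r in `[0%R, +oo[) (jump_loss 1 r)%:E)%E.

(** Replacing r by |c| r reduces c to 1; this factor |c| is the source of the L1 norm. *)
Lemma integral_jump_loss c :
  (\int[mu]_(r in `[0%R, +oo[) (jump_loss c r)%:E = `|c|%:E * jump_rate)%E.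
Proof.
have [->|c0] := eqVneq c 0.
  rewrite normr0 mul0e; under eq_integral do rewrite jump_loss0.
  by rewrite integral_cst// mul0e.
under eq_integral do rewrite -jump_loss_norm.
have {c0} : 0 < `|c| by rewrite normr_gt0.
move: `|c| => {}c c0.
rewrite /jump_rate [LHS]integral_mkcond [in RHS]integral_mkcond.
rewrite (ge0_integral_affine 0 c0); last 2 first.
- apply/(measurable_restrictT _ _).1 => //; apply/measurable_EFinP.
  by apply: measurable_funTS; exact: measurable_jump_loss.
- by apply: erestrict_ge0 => r _; rewrite lee_fin jump_loss_ge0.
congr (_ * _)%E; apply: eq_integral => r _; rewrite addr0 !patchE !mem_setE.
rewrite !in_itv/= !andbT pmulr_rge0//; case: ifP => // _.
by rewrite /jump_loss invfM mulrA divff ?gt_eqF.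
Qed.

Lemma jump_loss_le1 c r : jump_loss c r <= 1.
Proof. by rewrite gerBl expR_ge0. Qed.

(** The loss is at least 1 - exp(-1) on ]0,1], and at most min(1, 1/r^2) <= 2 / (1 + r^2), whose
    integral is finite. *)
Lemma jump_rate_fin : (0 < jump_rate < +oo)%E.
Proof.
apply/andP; split.
  apply: (@lt_le_trans _ _ (\int[mu]_(r in `]0%R, 1%R]) (1 - expR (-1))%:E)%E).
    rewrite integral_cst//= lebesgue_measure_itv/= lte_fin ltr01 oppr0 adde0 mule1.
    by rewrite lte_fin subr_gt0 -[ltRHS]expR0 ltr_expR ltrN10.
  apply: (@le_trans _ _ (\int[mu]_(r in `]0%R, 1%R]) (jump_loss 1 r)%:E)%E).
    apply: ge0_le_integral => //.
    - apply/measurable_EFinP; apply: measurable_funTS; exact: measurable_jump_loss.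
    - move=> r /=; rewrite in_itv/= => /andP[r0 r1].
      rewrite lee_fin lerB// ler_expR lerN2 div1r exprVn.
      by rewrite invf_ge1 ?exprn_gt0// exprn_ile1// ltW.
  apply: ge0_subset_integral => //.
  - apply/measurable_EFinP; apply: measurable_funTS; exact: measurable_jump_loss.
  - by move=> r _; rewrite lee_fin jump_loss_ge0.
  - by move=> r /=; rewrite !in_itv/= andbT => /andP[/ltW].
apply: (@le_lt_trans _ _ (\int[mu]_(r in `[0%R, +oo[) (2 * (oneDsqr r)^-1)%:E)%E).
  apply: ge0_le_integral => //.
  - by move=> r _; rewrite lee_fin jump_loss_ge0.
  - apply/measurable_EFinP; apply: measurable_funTS; exact: measurable_jump_loss.
  - apply/measurable_EFinP; apply: measurable_funTS; apply: measurable_funM => //.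
    exact: (continuous_measurable_fun continuous_oneDsqrV).
  - move=> r _; rewrite lee_fin /oneDsqr.
    have p1 : 0 < 1 + r ^+ 2 by rewrite ltr_wpDr// sqr_ge0.
    rewrite ler_pdivlMr//.
    have [r1|r1] := leP (r ^+ 2) 1.
      by have := jump_loss_ge0 1 r; have := jump_loss_le1 1 r; nra.
    have : jump_loss 1 r <= (1 / r) ^+ 2.
      by have := expR_ge1Dx (- (1 / r) ^+ 2); rewrite /jump_loss; lra.
    rewrite div1r exprVn => h; have : jump_loss 1 r * r ^+ 2 <= 1.
      by rewrite -ler_pdivlMr ?div1r// (lt_trans _ r1).
    by have := jump_loss_le1 1 r; nra.
under eq_integral do rewrite EFinM.
rewrite ge0_integralZl//.
- by rewrite integral0y_oneDsqr -EFinM ltry.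
- apply/measurable_EFinP; apply: measurable_funTS.
  exact: (continuous_measurable_fun continuous_oneDsqrV).
Qed.

End kernel_integral.

(** * Decomposition of the radial integral into unit shells *)

Section shells.
Context {R : realType}.
Local Notation W := (measurableTypeR R).
Local Notation P := (@uniform01 R).
Local Notation mu := (@lebesgue_measure R).

Lemma ge0_integral_uniform01 (f : R -> \bar R) : measurable_fun setT f ->
  (forall x, 0 <= f x)%E ->
  (\int[P]_w f w = \int[mu]_(x in `[0%R, 1%R]) f x)%E.
Proof.
move=> mf f0; set D : set W := `[0%R, 1%R]%classic.
have mD : measurable D by exact: measurable_itv.
rewrite (ge0_negligible_integral (N := ~` D))//.
- rewrite setTD setCK; apply: eq_measure_integral => A mA AD.
  by rewrite -[LHS]/(mu (A `&` D)) setIidl.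
- exact: measurableC.
- by rewrite -[LHS]/(mu (~` D `&` D)) setICl measure0.
Qed.

Lemma ge0_integral_shells (g : R -> R) : measurable_fun setT g ->
  (forall x, 0 <= g x) ->
  (\int[mu]_(r in `[0%R, +oo[) (g r)%:E =
   \sum_(k <oo) \int[P]_v (g (k%:R + (v : R)))%:E)%E.
Proof.
move=> mg g0; pose F k : set R := `[k%:R, k.+1%:R[%classic.
have FU : `[0%R, +oo[%classic = \bigcup_k F k.
  apply/seteqP; split => r /=; last first.
    by move=> [k _]; rewrite /F/= !in_itv/= andbT => /andP[kr _]; apply: le_trans kr.
  rewrite in_itv/= andbT => r0; exists (Num.truncn r) => //=.
  rewrite /F/= in_itv/=; exact: truncn_itv.
rewrite FU (@ge0_integral_bigcup _ _ _ mu F (fun r => (g r)%:E)); last 4 first.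
- by move=> k; exact: measurable_itv.
- by apply: measurable_funTS; exact/measurable_EFinP.
- by move=> x _; rewrite lee_fin.
- apply/trivIsetP => i j _ _; wlog ij : i j / (i < j)%N.
    move=> h; rewrite neq_lt => /orP[] ij; first by apply: h => //; rewrite ltn_eqF.
    by rewrite setIC; apply: h => //; rewrite ltn_eqF.
  move=> _; rewrite -subset0 => r [/=]; rewrite /F/= !in_itv/= => /andP[_ ri] /andP[jr _].
  have ij' : i.+1%:R <= j%:R :> R by rewrite ler_nat.
  by have := lt_le_trans ri (le_trans ij' jr); rewrite ltxx.
apply: eq_eseriesr => k _; rewrite ge0_integral_uniform01; last 2 first.
- apply/measurable_EFinP; apply: measurableT_comp => //.
  exact: measurable_funD.
- by move=> x; rewrite lee_fin.
rewrite integral_itv_bndo_bndc; last first.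
  by apply: measurable_funTS; exact/measurable_EFinP.
rewrite [LHS]integral_mkcond (ge0_integral_affine k%:R ltr01) ?mul1e; last 2 first.
- apply/(measurable_restrictT _ _).1 => //.
  by apply: measurable_funTS; exact/measurable_EFinP.
- by apply: erestrict_ge0 => r _; rewrite lee_fin.
rewrite [RHS]integral_mkcond; apply: eq_integral => r _.
rewrite !patchE !mem_setE mul1r !in_itv/= lerDr -natr1 [k%:R + 1]addrC lerD2r.
by rewrite addrC.
Qed.

Lemma cvg_series_nneseries (x : nat -> R) (S : R) : (forall k, 0 <= x k) ->
  (\sum_(k <oo) (x k)%:E = S%:E)%E -> series x @ \oo --> S.
Proof.
move=> x0 xS; suff : (EFin \o series x) @ \oo --> S%:E by move=> /fine_cvgP[_].
rewrite -[S%:E]xS (_ : EFin \o _ = (fun n => \sum_(0 <= k < n) (x k)%:E)%E).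
  by apply: is_cvg_nneseries => k _ _; rewrite lee_fin.
by apply/funext => n /=; rewrite sumEFin.
Qed.

(** By Tonelli the losses of all shells add up to the double integral over the half strip, and
    scaling in r evaluates its inner integral as [jump_rate] times |a u|. *)
Lemma cvg_series_shell (a : W -> R) (q : nat -> R) (S : R) :
  measurable_fun setT a ->
  (forall k, \int[P]_y (expR (- (a (even_bits y) /
     (k%:R + (odd_bits y : R))) ^+ 2))%:E = (q k)%:E)%E ->
  (\int[P]_u `|a u|%:E * jump_rate = S%:E)%E ->
  series (fun k => 1 - q k) @ \oo --> S.
Proof.
move=> ma aq aS.
have mjl k : measurable_fun setT (fun z : W * W => jump_loss (a z.1) (k%:R + (z.2 : R))).
  apply: measurable_jump_loss.
    exact: (measurableT_comp ma measurable_fst).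
  by apply: measurable_funD => //; exact: measurable_snd.
have mb : measurable_fun setT (fun w : W => (even_bits w, odd_bits w)).
  by apply: measurable_fun_pair; [exact: measurable_even_bits|exact: measurable_odd_bits].
have qE k : ((1 - q k)%:E =
    \int[P]_u \int[P]_v (jump_loss (a u) (k%:R + (v : R)))%:E)%E.
  rewrite -(ge0_integral_bits (F := fun z => (jump_loss (a z.1) (k%:R + (z.2 : R)))%:E)).
  (* The exponential and its loss add up to 1, so additivity for nonnegative integrands yields the
     integral of the loss. *)
  - have : (\int[P]_y (expR (- (a (even_bits y) / (k%:R + (odd_bits y : R))) ^+ 2))%:E +
      \int[P]_y (jump_loss (a (even_bits y)) (k%:R + (odd_bits y : R)))%:E = 1)%E.
      rewrite -ge0_integralD//.
      + under eq_integral do rewrite -EFinD /jump_loss addrC subrK.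
        by rewrite integral_cst// mul1e; exact: lebesgue01_setT.
      + apply/measurable_EFinP.
        rewrite (_ : (fun _ => _) = (fun y => 1 - jump_loss (a (even_bits y)) (k%:R + (odd_bits y : R)))).
          apply: measurable_funB => //; exact: (measurableT_comp (mjl k) mb).
        by apply/funext => y; rewrite /jump_loss subKr.
      + by move=> y _; rewrite lee_fin jump_loss_ge0.
      + by apply/measurable_EFinP; exact: (measurableT_comp (mjl k) mb).
    rewrite aq; case: (\int[P]_y _)%E => [r| |]//= [] <-.
    by rewrite [q k + _]addrC addrK.
  - exact/measurable_EFinP.
  - by move=> z; rewrite lee_fin jump_loss_ge0.
have q1 k : 0 <= 1 - q k.
  rewrite -lee_fin qE; apply: integral_ge0 => u _; apply: integral_ge0 => v _.
  by rewrite lee_fin jump_loss_ge0.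
apply: cvg_series_nneseries => //.
under eq_eseriesr do rewrite qE.
rewrite -integral_nneseries//; last 2 first.
- move=> k; have h := @measurable_fun_fubini_tonelli_F _ _ W W R P
    (fun z => (jump_loss (a z.1) (k%:R + (z.2 : R)))%:E).
  apply: h; last by move=> z; rewrite lee_fin jump_loss_ge0.
  exact/measurable_EFinP.
- by move=> k u _; apply: integral_ge0 => v _; rewrite lee_fin jump_loss_ge0.
rewrite -aS -ge0_integralZr//; last 2 first.
- by apply/measurable_EFinP; apply: measurableT_comp.
- by have /andP[/ltW] := @jump_rate_fin R.
apply: eq_integral => u _; rewrite -integral_jump_loss ge0_integral_shells//.
  exact: measurable_jump_loss.
by move=> r; exact: jump_loss_ge0.
Qed.
End shells.

(** * The Laplace transform of the target density *)

Section increasing_sets.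
Local Open Scope ereal_scope.
Context d (T : measurableType d) (R : realType).

Lemma cvg_integral_ndset (mu : {measure set T -> \bar R}) (D : nat -> set T)
    (f : T -> \bar R) :
  (forall n, measurable (D n)) -> (forall m n, (m <= n)%N -> D m `<=` D n) ->
  measurable_fun setT f -> (forall x, 0 <= f x) ->
  \int[mu]_(x in D n) f x @[n --> \oo] --> \int[mu]_(x in \bigcup_n D n) f x.
Proof.
move=> mD ndD mf f0.
rewrite integral_mkcond; under eq_fun do rewrite integral_mkcond.
have limE x : limn (fun n => (f \_ (D n)) x) = (f \_ (\bigcup_n D n)) x.
  apply: cvg_lim => //.
  have [[N _ DN]|nD] := pselect ((\bigcup_n D n) x).
    apply: cvg_near_cst; near=> n; rewrite !patchE.
    rewrite mem_set; last by apply: (ndD N) => //; near: n; exact: nbhs_infty_ge.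
    by rewrite mem_set//; exists N.
  rewrite patchE memNset// (_ : (fun _ => _) = cst 0); first exact: cvg_cst.
  by apply/funext => n; rewrite patchE memNset// => Dn; apply: nD; exists n.
have -> : \int[mu]_x (f \_ (\bigcup_n D n)) x =
    \int[mu]_x limn (fun n => (f \_ (D n)) x).
  by apply: eq_integral => x _; rewrite limE.
apply: cvg_monotone_convergence => //.
- move=> n; apply/(measurable_restrictT _ _).1 => //; exact: measurable_funTS.
- by move=> n x _; exact: erestrict_ge0.
- move=> x _ m n mn; rewrite !patchE; case: ifPn => [/set_mem Dm|_].
    by rewrite mem_set//; apply: ndD Dm.
  by case: ifP.
Unshelve. all: by end_near. Qed.
End increasing_sets.

(** * The Cauchy-Schloemilch substitution on compact intervals *)

Section target_laplace.
Context {R : realType}.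
Local Notation mu := (@lebesgue_measure R).
Implicit Types (F dF : R -> R).

(** Gathers the regularity conditions of the change of variables for a map that is C1 on ]0,+oo[; it
    serves both [cs_map] and the involution that negates it. *)
Lemma pos_C1_substitution F dF (a b : R) : 0 < a -> a < b ->
  (forall t : R, 0 < t -> is_derive t (1 : R) F (dF t)) ->
  (forall t : R, 0 < t -> {for t, continuous dF}) ->
  [/\ {in `]a, b[, continuous (derive1 F)}, cvg ((derive1 F) x @[x --> a^'+]),
      cvg ((derive1 F) x @[x --> b^'-]) & derivable_oo_LRcontinuous F a b].
Proof.
move=> a0 ab FdF cdF; have b0 := lt_trans a0 ab.
have dE (t : R) : 0 < t -> (derive1 F) t = dF t.
  by move=> t0; rewrite derive1E; have := FdF _ t0 => ?; rewrite derive_val.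
have cF' (t : R) : 0 < t -> (derive1 F) x @[x --> t] --> (derive1 F) t.
  move=> t0; rewrite dE//; apply: cvg_trans (cdF _ t0).
  apply: near_eq_cvg; near=> x; rewrite dE//.
  by near: x; exact: lt_nbhsr.
have cF (t : R) : 0 < t -> F x @[x --> t] --> F t.
  move=> t0; apply: differentiable_continuous; apply/derivable1_diffP.
  by have [] := FdF _ t0.
split.
- by move=> t /[!in_itv]/= /andP[at_ _]; apply: cF'; exact: lt_trans at_.
- by apply: (cvgP ((derive1 F) a)); apply: cvg_at_right_filter; exact: cF'.
- by apply: (cvgP ((derive1 F) b)); apply: cvg_at_left_filter; exact: cF'.
- split.
  + by move=> t /[!in_itv]/= /andP[at_ _]; have [] := FdF _ (lt_trans a0 at_).
  + by apply: cvg_at_right_filter; exact: cF.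
  + by apply: cvg_at_left_filter; exact: cF.
Unshelve. all: by end_near. Qed.


Lemma is_derive_inv (t : R) : 0 < t -> is_derive t (1 : R) GRing.inv (- t ^- 2).
Proof.
move=> t0; have /is_deriveV/= := is_derive_id t (1 : R).
by move=> /(_ (lt0r_neq0 t0)); rewrite /GRing.scale/= mulr1.
Qed.

Section cauchy_schloemilch.
Variable l : R.
Hypothesis l0 : 0 < l.

Definition cs_map (t : R) : R := l * t - 2^-1 * t^-1.

Lemma is_derive_cs_map (t : R) : 0 < t ->
  is_derive t (1 : R) cs_map (l + 2^-1 * t ^- 2).
Proof.
move=> t0; have dV := is_derive_inv t0.
rewrite /cs_map; apply: is_derive_eq.
by rewrite /GRing.scale/= !mulr1 mulrN opprK.
Qed.

Lemma cs_map_increasing : {in `]0, +oo[ &, {homo cs_map : x y / x < y}}.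
Proof.
move=> x y; rewrite !in_itv/= !andbT => x0 y0 xy; rewrite /cs_map.
by rewrite ltrB// ?ltr_pM2l// ltf_pV2.
Qed.

(** This involution drives the substitution: it preserves the square of [cs_map] and exchanges the
    weights l dt and dt / (2 t^2). *)
Lemma cs_map_flip t : 0 < t -> cs_map ((2 * l)^-1 * t^-1) = - cs_map t.
Proof. by move=> t0; rewrite /cs_map; field; rewrite !gt_eqF. Qed.

Lemma continuous_cs_map (t : R) : 0 < t -> {for t, continuous cs_map}.
Proof.
move=> t0; apply: differentiable_continuous; apply/derivable1_diffP.
by have [] := is_derive_cs_map t0.
Qed.

Lemma continuous_expR_cs_map (t : R) : 0 < t ->
  {for t, continuous (fun t => expR (- cs_map t ^+ 2))}.
Proof.
move=> t0; apply: (@continuous_comp _ _ _ cs_map (fun y => expR (- y ^+ 2))).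
  exact: continuous_cs_map.
exact: continuous_gauss_fun.
Qed.

Lemma continuous_invX2 (t : R) : 0 < t -> {for t, continuous (fun t : R => t ^- 2)}.
Proof.
move=> t0; apply: cvgV; first by rewrite expf_eq0/= gt_eqF.
exact: exprn_continuous.
Qed.

Section compact.
Variables a M : R.
Hypotheses (a0 : 0 < a) (aM : a < M) (lam : 2 * l * a * M = 1).

Let M0 : 0 < M. Proof. exact: lt_trans aM. Qed.

(** The relation 2 l a M = 1 makes [a, M] stable under [flip], hence its image under [cs_map]
    symmetric about 0. *)
Let flip (t : R) : R := (2 * l)^-1 * t^-1.

Let flip_a : flip a = M.
Proof.
by rewrite /flip -invfM -[RHS](mulKf (x := 2 * l * a)) ?lam ?mulr1// !mulf_eq0 !gt_eqF.
Qed.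

Let flip_M : flip M = a.
Proof.
have e : 2 * l * M * a = 1 by rewrite mulrAC.
by rewrite /flip -invfM -[RHS](mulKf (x := 2 * l * M)) ?e ?mulr1// !mulf_eq0 !gt_eqF.
Qed.

Let pos_itv (t : R) : t \in `[a, M] -> 0 < t.
Proof. by rewrite in_itv/= => /andP[at_ _]; apply: lt_le_trans at_. Qed.

Let is_derive_flip (t : R) : 0 < t ->
  is_derive t (1 : R) flip (- ((2 * l)^-1 * t ^- 2)).
Proof.
move=> t0; have dV := is_derive_inv t0.
by rewrite /flip; apply: is_derive_eq; rewrite /GRing.scale/= mulrN.
Qed.

Let integral_flip :
  (\int[mu]_(t in `[a, M]) (expR (- cs_map t ^+ 2) * l)%:E =
   \int[mu]_(t in `[a, M]) (expR (- cs_map t ^+ 2) * (2^-1 * t ^- 2))%:E)%E.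
Proof.
have [c1 c2 c3 c4] := pos_C1_substitution a0 aM is_derive_flip
  (fun t t0 => cvgN (cvgMr (continuous_invX2 t0))).
have := @integration_by_substitution_decreasing R flip
  (fun t => expR (- cs_map t ^+ 2) * l) a M (ltW aM) _ c1 c2 c3 c4.
rewrite flip_a flip_M => ->.
- apply: eq_integral => t /[!inE] taM; congr EFin.
  rewrite /= !fctE /=; have t0 := pos_itv taM.
  rewrite cs_map_flip// sqrrN derive1E.
  have := is_derive_flip t0 => ?; rewrite derive_val opprK -mulrA; congr (_ * _).
  by field; rewrite !gt_eqF.
- move=> x y xaM yaM xy; rewrite /flip ltr_pM2l ?invr_gt0 ?mulr_gt0//.
  by rewrite ltf_pV2// posrE pos_itv.
- apply: continuous_in_subspaceT => t /[!inE] taM.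
  by apply: cvgMl; apply: continuous_expR_cs_map; exact: pos_itv.
Qed.

(** Writing t^(-2) as twice 1/(2 t^2) and flipping one of the halves turns the weight into l + 1/(2
    t^2), the derivative of [cs_map]. *)
Lemma integral_compact_cs :
  (\int[mu]_(t in `[a, M]) (expR (- cs_map t ^+ 2) * t ^- 2)%:E =
   \int[mu]_(y in `[(- cs_map M)%R, cs_map M]) (gauss_fun y)%:E)%E.
Proof.
have [c1 c2 c3 c4] := pos_C1_substitution a0 aM is_derive_cs_map
  (fun t t0 => cvgD (cvg_cst l) (cvgMr (continuous_invX2 t0))).
have := @integration_by_substitution_increasing R cs_map
  (@gauss_fun R) a M (ltW aM) _ c1 c2 c3 c4.
have -> : cs_map a = - cs_map M by rewrite -flip_M cs_map_flip.
move=> ->; last 2 first.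
- move=> x y xaM yaM xy; apply: cs_map_increasing => //;
  by rewrite in_itv/= andbT pos_itv.
- by apply: continuous_subspaceT; exact: continuous_gauss_fun.
have mf (c : R -> R) : (forall t : R, 0 < t -> {for t, continuous c}) ->
    measurable_fun `[a, M] (fun t => expR (- cs_map t ^+ 2) * c t).
  move=> cc; apply: subspace_continuous_measurable_fun => //.
  apply: continuous_in_subspaceT => t /[!inE] taM.
  by apply: cvgM; [apply: continuous_expR_cs_map|apply: cc]; exact: pos_itv.
have half : forall t : R, 0 < t -> {for t, continuous (fun t : R => 2^-1 * t ^- 2)}.
  by move=> t t0; apply: cvgMr; exact: continuous_invX2.
transitivity (\int[mu]_(t in `[a, M]) ((expR (- cs_map t ^+ 2) * (2^-1 * t ^- 2))%:E +
   (expR (- cs_map t ^+ 2) * (2^-1 * t ^- 2))%:E))%E.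
  apply: eq_integral => t _; rewrite -EFinD; congr EFin.
  by rewrite -mulrDr -mulrDl -[2^-1]div1r -splitr mul1r.
have ge0 (c : R -> R) : (forall t, 0 <= c t) -> forall t, `[a, M]%classic t ->
    (0 <= (expR (- cs_map t ^+ 2) * c t)%:E)%E.
  by move=> c0 t _; rewrite lee_fin mulr_ge0 ?expR_ge0.
have c0 t : 0 <= 2^-1 * t ^- 2 :> R by rewrite mulr_ge0// invr_ge0 sqr_ge0.
rewrite ge0_integralD//; [|exact: ge0|by apply/measurable_EFinP; exact: mf
  |exact: ge0|by apply/measurable_EFinP; exact: mf].
rewrite -{1}integral_flip -ge0_integralD//; last 4 first.
- by apply: ge0 => _; exact: ltW.
- by apply/measurable_EFinP; apply: mf => t _; exact: cvg_cst.
- exact: ge0.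
- by apply/measurable_EFinP; exact: mf.
apply: eq_integral => t /[!inE] taM; rewrite -EFinD; congr EFin.
rewrite /= !fctE -mulrDr derive1E; have t0 := pos_itv taM.
by have := is_derive_cs_map t0 => ?; rewrite derive_val.
Qed.
End compact.
End cauchy_schloemilch.
End target_laplace.

(** * Laplace transform and total mass of the target density *)

Section target.
Context {R : realType}.
Local Notation mu := (@lebesgue_measure R).

Lemma integral_cs (l : R) : 0 < l ->
  (\int[mu]_(t in `]0%R, +oo[) (expR (- cs_map l t ^+ 2) * t ^- 2)%:E =
   (Num.sqrt pi)%:E)%E.
Proof.
move=> l0.
(* The factor 1 + 1/l makes both [hi n] and [l * hi n] at least n + 1. With the lower end tied to it
   by 2 l lo hi = 1, the intervals exhaust ]0,+oo[ while their images exhaust the line. *)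
pose hi n : R := n.+1%:R * (1 + l^-1).
have li0 : 0 < l^-1 by rewrite invr_gt0.
have n1 n : 1 <= n.+1%:R :> R by rewrite ler1n.
have hi1 n : 1 < hi n.
  by rewrite /hi; have := n1 n; nra.
have hi0 n : 0 < hi n by exact: lt_trans (hi1 n).
have hil n : n.+1%:R <= l * hi n.
  rewrite /hi mulrCA mulrDr mulr1 mulfV ?gt_eqF//.
  by have := n1 n; nra.
have hile m n : (m <= n)%N -> hi m <= hi n.
  by move=> mn; rewrite ler_wpM2r ?ler_nat// addr_ge0// ltW.
pose lo n : R := (2 * l)^-1 * (hi n)^-1.
have lo0 n : 0 < lo n by rewrite mulr_gt0// invr_gt0// mulr_gt0.
have lohi n : lo n < hi n.
  have c0 : 0 < 2 * l * hi n by apply: mulr_gt0 => //; exact: mulr_gt0.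
  rewrite /lo -invfM invf_plt ?posrE//.
  apply: (@lt_trans _ _ 1); first by rewrite invf_lt1.
  by have := hil n; have := n1 n; have := hi1 n; nra.
have lole m n : (m <= n)%N -> lo n <= lo m.
  by move=> mn; rewrite ler_pM2l ?invr_gt0 ?mulr_gt0// lef_pV2 ?posrE// hile.
have lam n : 2 * l * lo n * hi n = 1.
  by rewrite /lo; field; rewrite !gt_eqF.
pose D n : set R := `[lo n, hi n]%classic.
pose v n := cs_map l (hi n).
have vle m n : (m <= n)%N -> v m <= v n.
  move=> mn; rewrite /v /cs_map lerB ?ler_pM2l ?hile//.
  by rewrite lef_pV2 ?posrE// hile.
pose E n : set R := `[(- v n)%R, v n]%classic.
have DU : \bigcup_n D n = `]0, +oo[%classic.
  apply/seteqP; split => t /=; rewrite /D.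
    by move=> [n _ /=]; rewrite !in_itv/= andbT => /andP[+ _]; exact: lt_le_trans.
  rewrite in_itv/= andbT => t0; set N := Num.truncn (t + t^-1).
  have tN : t + t^-1 < N.+1%:R by exact: truncnS_gt.
  have ti0 : 0 < t^-1 by rewrite invr_gt0.
  exists N => //=; rewrite in_itv/=; apply/andP; split.
    have c0 : 0 < 2 * l * hi N by apply: mulr_gt0 => //; exact: mulr_gt0.
    rewrite /lo -invfM invf_ple ?posrE//.
    by have := hil N; nra.
  by rewrite /hi; have := n1 N; nra.
have EU : \bigcup_n E n = setT.
  apply/seteqP; split => // y _; set N := Num.truncn `|y|.
  have yN : `|y| < N.+1%:R by exact: truncnS_gt.
  (* The extra 1 in the index outweighs the term 1/(2 hi), which is at most 1/2. *)
  exists N.+1 => //; rewrite /E/= in_itv/= -ler_norml.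
  have : (hi N.+1)^-1 <= 1 by rewrite invf_le1// ltW.
  have := hil N.+1; rewrite -(@natr1 R N.+1) /v /cs_map; lra.
have mf : measurable_fun setT (fun t : R => (expR (- cs_map l t ^+ 2) * t ^- 2)%:E).
  apply/measurable_EFinP; apply: measurable_funM.
    apply: measurableT_comp => //; apply: measurableT_comp => //.
    apply: measurable_funX; apply: measurable_funB; first exact: measurable_funM.
    by apply: measurable_funM => //; exact: measurable_inv.
  by apply: (measurableT_comp (@measurable_inv R)); exact: measurable_funX.
have cD : (\int[mu]_(t in D n) (expR (- cs_map l t ^+ 2) * t ^- 2)%:E @[n --> \oo] -->
    \int[mu]_(t in `]0%R, +oo[) (expR (- cs_map l t ^+ 2) * t ^- 2)%:E)%E.
  rewrite -DU; apply: cvg_integral_ndset => //.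
  - by move=> n; exact: measurable_itv.
  - move=> m n mn t; rewrite /D/= !in_itv/= => /andP[a b].
    by rewrite (le_trans (lole _ _ mn) a) (le_trans b (hile _ _ mn)).
  - by move=> t; rewrite lee_fin mulr_ge0 ?expR_ge0// invr_ge0 sqr_ge0.
have cE : (\int[mu]_(y in E n) (gauss_fun y)%:E @[n --> \oo] -->
    (Num.sqrt pi)%:E)%E.
  rewrite -integralT_gauss -EU; apply: cvg_integral_ndset => //.
  - by move=> n; exact: measurable_itv.
  - move=> m n mn t; rewrite /E/= !in_itv/= => /andP[a b].
    by have := vle _ _ mn; lra.
  - by apply/measurable_EFinP; exact: measurable_gauss_fun.
  - by move=> y; rewrite lee_fin gauss_fun_ge0.
have DE : (fun n => \int[mu]_(t in D n) (expR (- cs_map l t ^+ 2) * t ^- 2)%:E)%E =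
    (fun n => \int[mu]_(y in E n) (gauss_fun y)%:E)%E.
  by apply/funext => n; exact: integral_compact_cs.
by rewrite DE in cD; exact: (cvg_unique _ cD cE).
Qed.

Definition target_density (t : R) : R :=
  expR (- (1 / (4 * t ^+ 2))) / (t ^+ 2 * Num.sqrt pi).

Lemma target_density_ge0 t : 0 <= target_density t.
Proof. by rewrite divr_ge0 ?expR_ge0// mulr_ge0 ?sqr_ge0 ?sqrtr_ge0. Qed.

Lemma measurable_target_density : measurable_fun setT target_density.
Proof.
have mV (f : R -> R) : measurable_fun setT f -> measurable_fun setT (fun t => (f t)^-1).
  exact: (measurableT_comp (@measurable_inv R)).
apply: measurable_funM.
  apply: measurableT_comp => //; apply: measurableT_comp => //.
  by apply: measurable_funM => //; apply: mV; apply: measurable_funM => //; exact: measurable_funX.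
by apply: mV; apply: measurable_funM => //; exact: measurable_funX.
Qed.

(** Completing the square: l t^2 + 1/(4 t^2) = sqrt l + (sqrt l t - 1/(2 t))^2, so the substitution
    is used with parameter sqrt l. *)
Lemma laplace_target_pos (l : R) : 0 < l ->
  (\int[mu]_(t in `]0%R, +oo[) (expR (- (l * t ^+ 2)) * target_density t)%:E =
   (expR (- Num.sqrt l))%:E)%E.
Proof.
move=> l0; have s0 : 0 < Num.sqrt l by rewrite sqrtr_gt0.
have p0 : 0 < Num.sqrt pi :> R by rewrite sqrtr_gt0 pi_gt0.
transitivity (\int[mu]_(t in `]0%R, +oo[) ((expR (- Num.sqrt l) / Num.sqrt pi)%:E *
   (expR (- cs_map (Num.sqrt l) t ^+ 2) * t ^- 2)%:E))%E.
  apply: eq_integral => t /[!inE]/=; rewrite in_itv/= andbT => t0.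
  rewrite -EFinM; congr EFin.
  rewrite [RHS](_ : _ = (expR (- Num.sqrt l) * expR (- cs_map (Num.sqrt l) t ^+ 2)) / (t ^+ 2 * Num.sqrt pi)); last first.
    by field; rewrite !gt_eqF.
  rewrite /target_density mulrA -!expRD; congr (expR _ / _).
  rewrite /cs_map -[in LHS](sqr_sqrtr (ltW l0)).
  by field; rewrite gt_eqF.
rewrite ge0_integralZl//.
- rewrite integral_cs// -EFinM; congr EFin.
  by rewrite divfK// gt_eqF.
- apply: measurable_funTS; apply/measurable_EFinP; apply: measurable_funM.
    apply: measurableT_comp => //; apply: measurableT_comp => //.
    apply: measurable_funX; apply: measurable_funB; first exact: measurable_funM.
    by apply: measurable_funM => //; exact: measurable_inv.
  by apply: (measurableT_comp (@measurable_inv R)); exact: measurable_funX.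
- by move=> t _; rewrite lee_fin mulr_ge0 ?expR_ge0// invr_ge0 sqr_ge0.
Qed.

(** The involution degenerates at l = 0, so the total mass is reached by monotone convergence from
    the transforms at l = 1/(n+1). *)
Lemma integral_target_density :
  (\int[mu]_(t in `]0%R, +oo[) (target_density t)%:E = 1)%E.
Proof.
pose g n t : R := expR (- (n.+1%:R^-1 * t ^+ 2)) * target_density t.
have mg n : measurable_fun setT (g n).
  apply: measurable_funM; last exact: measurable_target_density.
  apply: measurableT_comp => //; apply: measurableT_comp => //.
  by apply: measurable_funM => //; exact: measurable_funX.
have cn : (fun n => n.+1%:R^-1 : R) @ \oo --> (0 : R) by exact: cvg_harmonic.
have limg t : limn (fun n => (g n t)%:E) = (target_density t)%:E.
  apply: cvg_lim => //; apply: cvg_EFin; first by near=> n.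
  rewrite /comp /g/= -[X in _ --> X]mul1r; apply: cvgMl.
  have : expR (- (n.+1%:R^-1 * t ^+ 2)) @[n --> \oo] --> expR (- (0 * t ^+ 2)).
    apply: continuous_cvg; first exact: continuous_expR.
    by apply: cvgN; apply: cvgMl; exact: cn.
  by rewrite mul0r oppr0 expR0.
have cI : (\int[mu]_(t in `]0%R, +oo[) (g n t)%:E @[n --> \oo] -->
    \int[mu]_(t in `]0%R, +oo[) (target_density t)%:E)%E.
  have -> : (\int[mu]_(t in `]0%R, +oo[) (target_density t)%:E =
      \int[mu]_(t in `]0%R, +oo[) limn (fun n => (g n t)%:E))%E.
    by apply: eq_integral => t _; rewrite limg.
  apply: cvg_monotone_convergence => //.
  - by move=> n; apply/measurable_EFinP; apply: measurable_funTS; exact: mg.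
  - by move=> n t _; rewrite lee_fin mulr_ge0 ?expR_ge0// target_density_ge0.
  - move=> t _ m n mn; rewrite lee_fin /g ler_wpM2r ?target_density_ge0//.
    by rewrite ler_expR lerN2 ler_wpM2r ?sqr_ge0// lef_pV2 ?posrE// ler_nat ltnS.
apply: (cvg_unique _ cI) => //.
rewrite (_ : (fun n => _) = (fun n => (expR (- Num.sqrt n.+1%:R^-1))%:E)); last first.
  by apply/funext => n; apply: laplace_target_pos; rewrite invr_gt0.
apply: cvg_EFin; first by near=> n.
have : expR (- Num.sqrt n.+1%:R^-1) @[n --> \oo] --> expR (- Num.sqrt (0 : R)).
  apply: continuous_cvg; first exact: continuous_expR.
  by apply: cvgN; apply: continuous_cvg; [exact: sqrt_continuous|exact: cn].
by rewrite sqrtr0 oppr0 expR0.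
Unshelve. all: by end_near. Qed.

Lemma laplace_target (l : R) : 0 <= l ->
  (\int[mu]_(t in `]0%R, +oo[) (expR (- (l * t ^+ 2)) * target_density t)%:E =
   (expR (- Num.sqrt l))%:E)%E.
Proof.
rewrite le_eqVlt => /predU1P[<-|]; last exact: laplace_target_pos.
rewrite sqrtr0 oppr0 expR0 -integral_target_density; apply: eq_integral => t _.
by rewrite mul0r oppr0 expR0 mul1r.
Qed.

End target.

(** * Inversion of the Laplace transform *)

Section laplace_inversion.
Context {R : realType}.

(* [(1 - y^n)^N] with [N ~ n e^(n b)] tends, for [y = e^(-s)], to the indicator of [s > b] *)
Definition inversion_exponent (b : R) n := (Num.truncn (n.+1%:R * expR (n.+1%:R * b))).+1.

Definition inversion_poly (b : R) n : {poly R} :=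
  (1 - 'X^(n.+1)) ^+ inversion_exponent b n.

Lemma inversion_polyE b n (s : R) :
  (inversion_poly b n).[expR (- s)] =
  (1 - expR (- (n.+1%:R * s))) ^+ inversion_exponent b n.
Proof.
by rewrite /inversion_poly horner_exp !hornerE -expRM_natl mulrN.
Qed.

Lemma bernoulli_inequality (y : R) N : 0 <= y <= 1 -> 1 - N%:R * y <= (1 - y) ^+ N.
Proof.
move=> /andP[y0 y1]; elim: N => [|N ih]; first by rewrite mul0r subr0 expr0.
rewrite exprS; apply: le_trans (ler_wpM2l _ ih); last by rewrite subr_ge0.
have : 0 <= N%:R * y ^+ 2 by rewrite mulr_ge0// sqr_ge0.
by rewrite -natr1; nra.
Qed.

Lemma pow_le_expR (y : R) N : y <= 1 -> (1 - y) ^+ N <= expR (- (N%:R * y)).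
Proof.
move=> y1; rewrite -mulrN mulrC expRM_natr lerXn2r ?nnegrE ?subr_ge0 ?expR_ge0//.
exact: expR_ge1Dx.
Qed.

Lemma cvg_nat_expRN (c : R) : 0 < c ->
  n.+1%:R * expR (- (n.+1%:R * c)) @[n --> \oo] --> (0 : R).
Proof.
move=> c0; apply: (@squeeze_cvgr _ _ _ _ (cst 0) (fun n => 4 / c ^+ 2 * n.+1%:R^-1)).
- near=> n; have n0 : 0 < n.+1%:R :> R by rewrite ltr0n.
  rewrite mulr_ge0 ?expR_ge0//=.
  have nc0 : 0 <= n.+1%:R * c / 2 by rewrite divr_ge0// mulr_ge0// ltW.
  (* From exp(z) = exp(z/2)^2 and exp(z/2) >= z/2, which is where the bound with 4 / c^2 comes
     from. *)
  have h : (n.+1%:R * c / 2) ^+ 2 <= expR (n.+1%:R * c).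
    have : n.+1%:R * c / 2 <= expR (n.+1%:R * c / 2).
      by have := expR_ge1Dx (n.+1%:R * c / 2); lra.
    move=> h; rewrite [X in expR X]splitr expRD -expr2.
    by rewrite lerXn2r// ?nnegrE ?expR_ge0.
  rewrite expRN ler_pdivrMr ?expR_gt0//.
  apply: (@le_trans _ _ (4 / c ^+ 2 * n.+1%:R^-1 * (n.+1%:R * c / 2) ^+ 2)).
    by rewrite le_eqVlt; apply/orP; left; apply/eqP; field; rewrite !gt_eqF.
  apply: ler_wpM2l => //; apply: mulr_ge0; last by rewrite invr_ge0.
  by rewrite divr_ge0// sqr_ge0.
- exact: cvg_cst.
- rewrite -(mulr0 (4 / c ^+ 2)); apply: cvgMr; exact: cvg_harmonic.
Unshelve. all: by end_near. Qed.

Lemma cvg_expRN (c : R) : 0 < c ->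
  expR (- (n.+1%:R * c)) @[n --> \oo] --> (0 : R).
Proof.
move=> c0; apply: (@squeeze_cvgr _ _ _ _ (cst 0)
  (fun n => n.+1%:R * expR (- (n.+1%:R * c)))).
- by near=> n; rewrite expR_ge0/= ler_peMl ?expR_ge0// ler1n.
- exact: cvg_cst.
- exact: cvg_nat_expRN.
Unshelve. all: by end_near. Qed.

Lemma inversion_poly_bounds (b s : R) n : 0 <= s ->
  0 <= (inversion_poly b n).[expR (- s)] <= 1.
Proof.
move=> s0; rewrite inversion_polyE.
have e1 : expR (- (n.+1%:R * s)) <= 1.
  by rewrite -[leRHS]expR0 ler_expR oppr_le0 mulr_ge0.
by rewrite exprn_ge0 ?subr_ge0// exprn_ile1 ?subr_ge0// gerBl expR_ge0.
Qed.

(** With y = exp(-(n+1) s), the product of y and the exponent behaves like (n+1) exp((n+1) (b - s)):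
    it tends to 0 for s > b, where Bernoulli's inequality applies, and is at least n + 1 for s <= b,
    where 1 - y <= exp(-y) applies. The factor n + 1 settles the boundary case s = b. *)
Lemma cvg_inversion_poly (b s : R) : 0 <= b -> 0 <= s ->
  (inversion_poly b n).[expR (- s)] @[n --> \oo] --> ((b < s)%R%:R : R).
Proof.
move=> b0 s0; under eq_fun do rewrite inversion_polyE.
have e01 n : 0 <= expR (- (n.+1%:R * s)) <= 1.
  by rewrite expR_ge0 -[leRHS]expR0 ler_expR oppr_le0 mulr_ge0.
set N := inversion_exponent b.
have expo_ge n : n.+1%:R * expR (n.+1%:R * b) <= (N n)%:R.
  by apply/ltW; exact: truncnS_gt.
have expo_le n : (N n)%:R <= n.+1%:R * expR (n.+1%:R * b) + 1.
  rewrite /N /inversion_exponent -[leLHS]natr1 lerD2r truncn_le.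
  by rewrite mulr_ge0// expR_ge0.
have [bs|sb] := ltP b s.
  apply: (@squeeze_cvgr _ _ _ _ (fun n => 1 - (n.+1%:R * expR (- (n.+1%:R * (s - b))) +
    expR (- (n.+1%:R * s)))) (cst 1)).
  - near=> n; have := e01 n => /andP[e0 e1].
    rewrite exprn_ile1 ?subr_ge0// ?gerBl// andbT.
    apply: le_trans (bernoulli_inequality _ (e01 n)).
    rewrite lerB//; apply: le_trans (ler_wpM2r e0 (expo_le n)) _.
    rewrite mulrDl mul1r lerD2r -mulrA -expRD ler_wpM2l// ler_expR.
    by rewrite mulrBr; lra.
  - rewrite -[X in _ --> X](subr0 1); apply: cvgB; first exact: cvg_cst.
    rewrite -[X in _ --> X](addr0 0); apply: cvgD.
      by apply: cvg_nat_expRN; rewrite subr_gt0.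
    by apply: cvg_expRN; apply: le_lt_trans bs.
  - exact: cvg_cst.
apply: (@squeeze_cvgr _ _ _ _ (cst 0) (fun n => expR (- (n.+1%:R * 1)))).
- near=> n; have := e01 n => /andP[e0 e1].
  rewrite exprn_ge0 ?subr_ge0//=; apply: le_trans (pow_le_expR _ e1) _.
  rewrite ler_expR lerN2 mulr1.
  apply: le_trans (ler_wpM2r e0 (expo_ge n)).
  rewrite -mulrA -expRD ler_peMr// -[leLHS]expR0 ler_expR -mulrBr.
  by rewrite mulr_ge0// subr_ge0.
- exact: cvg_cst.
- exact: cvg_expRN.
Unshelve. all: by end_near. Qed.

End laplace_inversion.

Section laplace_ray.
Context {R : realType} d (T : measurableType d) (m : {measure set T -> \bar R}).

(** The converging sequence depends on L alone, so two weighted measures with the same L give equal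
    mass to b < X^2. Integer arguments suffice, since polynomials in exp(-X^2) involve no others.
    The weight w lets the statement cover both a probability and a density. *)
Lemma cvg_laplace_ray (D : set T) (X w : T -> R) (L : nat -> R) (b : R) :
  measurable D -> measurable_fun setT X -> measurable_fun setT w ->
  (forall x, 0 <= w x) ->
  (forall i : nat, \int[m]_(x in D) (expR (- (i%:R * X x ^+ 2)) * w x)%:E = (L i)%:E)%E ->
  0 <= b ->
  ((\sum_(i < size (inversion_poly b n)) (inversion_poly b n)`_i * L i)%:E @[n --> \oo] -->
    \int[m]_(x in D `&` [set x | (b < X x ^+ 2)%R]) (w x)%:E)%E.
Proof.
move=> mD mX mw w0 XL b0.
have mX2 : measurable_fun setT (fun x => X x ^+ 2) by exact: measurable_funX.
have me (i : nat) : measurable_fun setT (fun x => expR (- (i%:R * X x ^+ 2)) * w x).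
  apply: measurable_funM => //; apply: measurableT_comp => //.
  by apply: measurableT_comp => //; exact: measurable_funM.
have ie i : m.-integrable D (fun x => (expR (- (i%:R * X x ^+ 2)) * w x)%:E).
  apply/integrableP; split; first by apply: measurable_funTS; exact/measurable_EFinP.
  under eq_integral do rewrite gee0_abs ?lee_fin ?mulr_ge0 ?expR_ge0//.
  by rewrite XL ltry.
(* The case i = 0 makes w integrable, so that it can serve as the dominating function. *)
have iw : m.-integrable D (fun x => (w x)%:E).
  have := ie 0%N; congr (m.-integrable D _); apply/funext => x.
  by rewrite mul0r oppr0 expR0 mul1r.
have mp n : measurable_fun setT (fun x => (inversion_poly b n).[expR (- X x ^+ 2)] * w x).
  apply: measurable_funM => //.
  under eq_fun do rewrite horner_coef.
  apply: measurable_sum => i; apply: measurable_funM => //.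
  apply: measurable_funX; apply: measurableT_comp => //.
  exact: measurableT_comp.
have IE n : (\int[m]_(x in D) ((inversion_poly b n).[expR (- X x ^+ 2)] * w x)%:E =
    (\sum_(i < size (inversion_poly b n)) (inversion_poly b n)`_i * L i)%:E)%E.
  transitivity (\int[m]_(x in D) (\sum_(i < size (inversion_poly b n))
      ((inversion_poly b n)`_i)%:E * (expR (- (i%:R * X x ^+ 2)) * w x)%:E))%E.
    apply: eq_integral => x _; rewrite horner_coef mulr_suml -sumEFin.
    apply: eq_bigr => i _; rewrite -EFinM -mulrA.
    by congr (_ * (_ * _))%:E; rewrite -expRM_natl mulrN.
  rewrite integral_sum//; last by move=> i; exact: integrableZl.
  rewrite -sumEFin; apply: eq_bigr => i _.
  by rewrite integralZl// XL.
have mS : measurable [set x | b < X x ^+ 2].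
  have -> : [set x | b < X x ^+ 2] = (fun x => X x ^+ 2) @^-1` `]b, +oo[%classic.
    by apply/seteqP; split => x /=; rewrite in_itv/= andbT.
  by rewrite -[X in measurable X]setTI; apply: mX2.
rewrite integral_mkcondr.
under eq_fun do rewrite -IE.
apply: (@dominated_cvg _ _ _ m D mD _ _ (fun x => (w x)%:E)) => //.
- by move=> n; apply: measurable_funTS; exact/measurable_EFinP.
- move=> x Dx; rewrite (_ : (_ \_ _) x = (((b < X x ^+ 2)%R%:R * w x)%:E)).
    apply: cvg_EFin; first by near=> n.
    apply: (@cvgMl _ _ _ _ (fun n => (inversion_poly b n).[expR (- X x ^+ 2)])).
    by apply: cvg_inversion_poly => //; exact: sqr_ge0.
  rewrite patchE; case: ifPn => [|/negP] bx.
    by move: bx; rewrite inE/= => ->; rewrite mul1r.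
  by case: ltP => //; rewrite ?mul0r// => h; exfalso; apply: bx; rewrite inE.
- move=> n x Dx; rewrite abse_EFin lee_fin normrM (ger0_norm (w0 x)).
  have /andP[p0 p1] := @inversion_poly_bounds _ b (X x ^+ 2) n (sqr_ge0 _).
  by rewrite ger0_norm// ler_piMl.
Unshelve. all: by end_near. Qed.
End laplace_ray.

(** * Identification of the law from integer Laplace arguments *)

Section target_law.
Context {R : realType}.
Local Notation W := (measurableTypeR R).
Local Notation mu := (@lebesgue_measure R).

Definition target_measure (A : set W) : \bar R :=
  (\int[mu]_(t in A `&` `]0%R, +oo[) (target_density t)%:E)%E.

Let target_measure0 : target_measure set0 = 0%E.
Proof. by rewrite /target_measure set0I integral_set0. Qed.

Let target_measure_ge0 A : (0 <= target_measure A)%E.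
Proof. by apply: integral_ge0 => t _; rewrite lee_fin target_density_ge0. Qed.

Let target_measure_sigma_additive : semi_sigma_additive target_measure.
Proof.
move=> /= F mF tF mUF; rewrite /target_measure; apply: cvg_toP.
  apply: ereal_nondecreasing_is_cvgn => m n mn.
  apply: lee_sum_nneg_natr => // k _ _; exact: target_measure_ge0.
rewrite setI_bigcupl (@ge0_integral_bigcup _ _ _ mu (fun n => F n `&` `]0%R, +oo[)
  (fun t => (target_density t)%:E))//.
- by move=> k; apply: measurableI => //; exact: measurable_itv.
- by apply: measurable_funTS; apply/measurable_EFinP; exact: measurable_target_density.
- by move=> t _; rewrite lee_fin target_density_ge0.
- exact: trivIset_setIr.
Qed.

HB.instance Definition _ := isMeasure.Build _ _ _
  target_measure target_measure0 target_measure_ge0 target_measure_sigma_additive.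

Lemma has_density_of_laplace d (Omega : measurableType d) (P : probability Omega R)
    (X : Omega -> R) : measurable_fun setT X -> (forall w, 0 <= X w) ->
  (forall i : nat, \int[P]_w (expR (- (i%:R * X w ^+ 2)))%:E =
    (expR (- Num.sqrt i%:R))%:E)%E ->
  has_density_on P X `]0, +oo[ target_density.
Proof.
move=> mX X0 XL; split => //.
- by apply: measurable_funTS; exact: measurable_target_density.
- by move=> t _; exact: target_density_ge0.
have mX' : measurable_fun setT (X : Omega -> W) by exact: mX.
suff PX A : measurable A -> image_measure P mX' A = target_measure A by exact: PX.
apply: eq_measure_rays => [a|]; last first.
  by rewrite -[ltLHS]/(P (X @^-1` setT)) preimage_setT probability_setT ltry.
rewrite -[LHS]/(P (X @^-1` `]a, +oo[%classic)).
rewrite -[RHS]/(\int[mu]_(t in `]a, +oo[ `&` `]0%R, +oo[) (target_density t)%:E)%E.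
have [a0|a0] := ltP a 0.
  rewrite (_ : _ @^-1` _ = setT); last first.
    by apply/seteqP; split => w //= _; rewrite in_itv/= andbT (lt_le_trans a0).
  rewrite probability_setT (_ : _ `&` _ = `]0, +oo[%classic) ?integral_target_density//.
  apply/setIidPr => t /=; rewrite !in_itv/= !andbT; exact: lt_trans a0.
have a20 : 0 <= a ^+ 2 by exact: sqr_ge0.
have c1 := @cvg_laplace_ray R _ _ P setT X (cst 1) (fun i => expR (- Num.sqrt i%:R))
  (a ^+ 2) measurableT mX (measurable_cst _) (fun _ => ler01).
have c2 := @cvg_laplace_ray R _ W mu `]0, +oo[%classic id target_density
   (fun i => expR (- Num.sqrt i%:R)) (a ^+ 2) (measurable_itv _) (@measurable_id _ W setT)
   measurable_target_density target_density_ge0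
   (fun i => laplace_target (ler0n _ i)) a20.
have XL' (i : nat) : (\int[P]_w (expR (- (i%:R * X w ^+ 2)) * cst 1 w)%:E =
    (expR (- Num.sqrt i%:R))%:E)%E.
  by rewrite -XL; apply: eq_integral => w _; rewrite /cst mulr1.
have {c1 c2} := cvg_unique _ (c1 XL' a20) c2.
rewrite setTI => h.
transitivity (\int[P]_(w in [set w | (a ^+ 2 < X w ^+ 2)%R]) (cst 1%R w)%:E)%E.
  rewrite (_ : [set _ | _] = X @^-1` `]a, +oo[%classic); last first.
    apply/seteqP; split => w /=; rewrite in_itv/= andbT;
      by rewrite ltr_pXn2r ?nnegrE.
  rewrite -[RHS]/(\int[P]_(w in X @^-1` `]a, +oo[) cst 1 w)%E integral_cst ?mul1e//.
  by rewrite -[X in measurable X]setTI; apply: mX => //; exact: measurable_itv.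
rewrite h //; congr (integral _ _ _).
apply/seteqP; split => t /=; rewrite !in_itv/= !andbT.
  by move=> [t0]; rewrite ltr_pXn2r ?nnegrE// ?(ltW t0).
by move=> [at_ t0]; rewrite ltr_pXn2r ?nnegrE// ?(ltW t0).
Qed.

End target_law.

(** * An orthonormal system in L2 *)

Section poisson_index.
Context {R : realType}.
Local Notation W := (measurableTypeR R).
Local Notation P := (@uniform01 R).

Definition poisson_slot k : set W :=
  [set w : W | poisson_cdf k <= (w : R) < poisson_cdf k.+1].

(** The Poisson quantile serves here to cut [0,1] into countably many sets of positive measure. Off
    the slots, that is outside [0,1[, it defaults to 0, which adds only a null set to the cell of
    index 0. *)
Definition poisson_index (w : W) : nat := xget 0%N [set k | poisson_slot k w].

Lemma poisson_indexE k w : poisson_slot k w -> poisson_index w = k.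
Proof.
have uniq i j : poisson_slot i w -> poisson_slot j w -> (i <= j)%N.
  move=> /andP[iw _] /andP[_ wj]; rewrite leqNgt; apply/negP => ji.
  have := le_lt_trans iw wj; rewrite ltNge poisson_cdf_nondecreasing//.
move=> kw; rewrite /poisson_index; case: xgetP => [i _ iw|/(_ k)//].
by apply/eqP; rewrite eqn_leq !uniq.
Qed.

Lemma measurable_poisson_slot k : measurable (poisson_slot k).
Proof.
rewrite (_ : poisson_slot k = `[poisson_cdf k, poisson_cdf k.+1[%classic :> set R).
  exact: measurable_itv.
by apply/seteqP; split => w /=; rewrite /poisson_slot/= in_itv.
Qed.

Lemma measurable_poisson_index_eq k : measurable [set w | poisson_index w = k].
Proof.
rewrite (_ : [set w | _] = poisson_slot k `|`
    (if k == 0%N then ~` \bigcup_i poisson_slot i else set0)).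
  apply: measurableU; first exact: measurable_poisson_slot.
  case: ifP => // _; apply: measurableC; apply: bigcup_measurable => i _.
  exact: measurable_poisson_slot.
apply/seteqP; split => w /=.
  rewrite /poisson_index; case: xgetP => [i _ iw <-|nw <-]; first by left.
  by right; rewrite eqxx => -[i _]; exact: nw.
move=> [/poisson_indexE//|]; case: ifP => // /eqP -> nw.
rewrite /poisson_index; case: xgetP => // i _ iw; exfalso; apply: nw.
by exists i.
Qed.

Lemma measurable_poisson_index (A : set nat) (f : W -> W) : measurable_fun setT f ->
  measurable [set w | A (poisson_index (f w))].
Proof.
move=> mf; rewrite (_ : [set w | _] =
  \bigcup_(k in A) (f @^-1` [set w | poisson_index w = k])).
  apply: bigcup_measurable => k _.
  rewrite -[X in measurable X]setTI; apply: mf => //.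
  exact: measurable_poisson_index_eq.
apply/seteqP; split => w /=; first by move=> Aw; exists (poisson_index (f w)).
by move=> [k Ak /= ->].
Qed.

Definition index_prob k : R := fine (P [set w | poisson_index w = k]).

Lemma index_probE k : P [set w | poisson_index w = k] = (index_prob k)%:E.
Proof.
by rewrite fineK//; apply: lebesgue01_fin_num; exact: measurable_poisson_index_eq.
Qed.

Lemma index_prob_gt0 k : 0 < index_prob k.
Proof.
rewrite -lte_fin -index_probE.
apply: (@lt_le_trans _ _ (P (poisson_slot k))); last first.
  apply: le_measure; rewrite ?inE.
  - exact: measurable_poisson_slot.
  - exact: measurable_poisson_index_eq.
  - by move=> w /poisson_indexE.
rewrite -[ltRHS]/(lebesgue_measure (poisson_slot k `&` `[0, 1])).
have c0 := poisson_cdf_bounds (R := R) k; have c1 := poisson_cdf_bounds (R := R) k.+1.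
have cc : poisson_cdf k < poisson_cdf k.+1 :> R.
  by rewrite poisson_cdfS ltrDl divr_gt0 ?expR_gt0// ltr0n fact_gt0.
rewrite (_ : _ `&` _ = `[poisson_cdf k, poisson_cdf k.+1[%classic :> set R).
  by rewrite lebesgue_measure_itv/= lte_fin cc -EFinD lte_fin subr_gt0.
by apply/seteqP; split => w; rewrite /poisson_slot/= !in_itv/=; lra.
Qed.

Lemma integral_poisson_index n (G : nat -> R) : (forall k, 0 <= G k) ->
  (\int[P]_w (if (poisson_index w < n)%N then G (poisson_index w) else 0)%:E =
   (\sum_(k < n) G k * index_prob k)%:E)%E.
Proof.
move=> G0.
have mi k : measurable_fun setT (\1_[set w : W | poisson_index w = k] : W -> R).
  by apply: measurable_indic; exact: measurable_poisson_index_eq.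
transitivity (\int[P]_w (\sum_(k < n) (G k)%:E * (\1_[set w : W | poisson_index w = k] w)%:E))%E.
  apply: eq_integral => w _; rewrite sumEFin; congr EFin; case: ifPn => wn.
    rewrite (bigD1 (Ordinal wn))//= indicE mem_set// mulr1 big1 ?addr0// => i /eqP iw.
    rewrite indicE memNset ?mulr0//= => wi; apply: iw; exact/val_inj.
  rewrite big1// => i _; rewrite indicE memNset ?mulr0//= => wi.
  by rewrite wi ltn_ord in wn.
rewrite ge0_integral_sum//; last 2 first.
- by move=> k; apply: measurable_funeM; exact/measurable_EFinP.
- by move=> k w _; rewrite mule_ge0 ?lee_fin.
rewrite -sumEFin; apply: eq_bigr => k _.
rewrite ge0_integralZl// ?lee_fin//; last by exact/measurable_EFinP.
rewrite integral_indic; last 2 first.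
- exact: measurableT.
- exact: measurable_poisson_index_eq.
by rewrite setIT [RHS]EFinM; congr (_ * _)%E; exact: index_probE.
Qed.

(* [step c] is the element of [L2] with coordinates [c k i] in the orthonormal
   system of normalised indicators of [N (even_bits y) = k, N (odd_bits y) = i] *)
Definition step (c : nat -> nat -> R) (y : W) : R :=
  let k := poisson_index (even_bits y) in let i := poisson_index (odd_bits y) in
  c k i / Num.sqrt (index_prob k * index_prob i).

Lemma measurable_step c : measurable_fun setT (step c).
Proof.
move=> _ B mB; rewrite setTI.
rewrite (_ : _ @^-1` _ = \bigcup_k \bigcup_(i in
    [set i | B (c k i / Num.sqrt (index_prob k * index_prob i))])
    ([set y | poisson_index (even_bits y) = k] `&`
     [set y | poisson_index (odd_bits y) = i])).
  apply: bigcup_measurable => k _; apply: bigcup_measurable => i _.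
  apply: measurableI.
    exact: (measurable_poisson_index [set k] measurable_even_bits).
  exact: (measurable_poisson_index [set i] measurable_odd_bits).
apply/seteqP; split => y /=.
  move=> By; exists (poisson_index (even_bits y)) => //.
  by exists (poisson_index (odd_bits y)).
by move=> [k _ [i /= Bki [/= yk yi]]]; rewrite /step yk yi.
Qed.

Lemma stepD (a : R) (c c' : nat -> nat -> R) y :
  step (fun k i => a * c k i + c' k i) y = a * step c y + step c' y.
Proof. by rewrite /step mulrDl mulrA. Qed.

(** One n bounds both indices, in step with [field_energy h n n], so that a single limit is
    taken. *)
Definition box (c : nat -> nat -> R) n : R := \sum_(k < n) \sum_(i < n) c k i ^+ 2.

Lemma box_ge0 c n : 0 <= box c n.
Proof. by apply: sumr_ge0 => k _; apply: sumr_ge0 => i _; exact: sqr_ge0. Qed.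

(** Parseval for a truncated array: by independence of the digit halves the cell (k, i) has measure
    [index_prob k * index_prob i], which cancels the normalisation in [step]. *)
Lemma integral_step_box c n :
  (\int[P]_y (if (poisson_index (even_bits y) < n)%N &&
                 (poisson_index (odd_bits y) < n)%N then step c y ^+ 2 else 0)%:E =
   (box c n)%:E)%E.
Proof.
pose F (z : W * W) := (let k := poisson_index z.1 in let i := poisson_index z.2 in
  if (k < n)%N && (i < n)%N then c k i ^+ 2 / (index_prob k * index_prob i) else 0)%:E.
have p0 k i : 0 < index_prob k * index_prob i by rewrite mulr_gt0 ?index_prob_gt0.
transitivity (\int[P]_y F (even_bits y, odd_bits y))%E.
  apply: eq_integral => y _; rewrite /F /step/=; case: ifP => // _; congr EFin.
  by rewrite exprMn exprVn sqr_sqrtr// ltW.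
rewrite ge0_integral_bits; last 2 first.
- apply/measurable_EFinP => _ B mB; rewrite setTI.
  pose S k i := B (if (k < n)%N && (i < n)%N
    then c k i ^+ 2 / (index_prob k * index_prob i) else 0).
  rewrite (_ : _ @^-1` _ = \bigcup_k \bigcup_(i in S k)
     ([set w | poisson_index w = k] `*` [set w | poisson_index w = i])).
    apply: bigcup_measurable => k _; apply: bigcup_measurable => i _.
    by apply: measurableX; exact: measurable_poisson_index_eq.
  apply/seteqP; split => -[u v] /=.
    move=> By; exists (poisson_index u) => //; by exists (poisson_index v).
  by move=> [k _ [i /= Bki [/= yk yi]]]; rewrite yk yi.
- move=> z; rewrite /F lee_fin; case: ifP => // _.
  by rewrite divr_ge0 ?sqr_ge0// ltW.
transitivity (\int[P]_u (if (poisson_index u < n)%N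
    then \sum_(i < n) (c (poisson_index u) i ^+ 2 / index_prob (poisson_index u)) else 0)%:E)%E.
  apply: eq_integral => u _; rewrite /F/=; case: ifPn => un; last first.
    by under eq_integral do rewrite /=; rewrite integral0.
  set k := poisson_index u.
  rewrite (integral_poisson_index n (G := fun i => c k i ^+ 2 / (index_prob k * index_prob i))).
    congr EFin; apply: eq_bigr => i _; field.
    by rewrite !gt_eqF ?index_prob_gt0.
  by move=> i; rewrite divr_ge0 ?sqr_ge0// ltW.
rewrite (integral_poisson_index n (G := fun k => \sum_(i < n) (c k i ^+ 2 / index_prob k))).
  congr EFin; apply: eq_bigr => k _; rewrite mulr_suml; apply: eq_bigr => i _.
  by rewrite divfK// gt_eqF// index_prob_gt0.
move=> k; apply: sumr_ge0 => i _; rewrite divr_ge0 ?sqr_ge0// ltW//.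
exact: index_prob_gt0.
Qed.

Lemma cvg_box c :
  (box c n)%:E @[n --> \oo] --> (\int[P]_y (step c y ^+ 2)%:E)%E.
Proof.
under eq_fun do rewrite -integral_step_box.
pose g n y : \bar R := (if (poisson_index (even_bits y) < n)%N &&
                 (poisson_index (odd_bits y) < n)%N then step c y ^+ 2 else 0)%:E.
have gE y : limn (g ^~ y) = (step c y ^+ 2)%:E.
  apply: cvg_lim => //; apply: cvg_near_cst; near=> n; rewrite /g.
  have -> : (poisson_index (even_bits y) < n)%N by near: n; exact: nbhs_infty_gt.
  by have -> : (poisson_index (odd_bits y) < n)%N by near: n; exact: nbhs_infty_gt.
have -> : (\int[P]_y (step c y ^+ 2)%:E = \int[P]_y limn (g ^~ y))%E.
  by apply: eq_integral => y _; rewrite gE.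
apply: cvg_monotone_convergence => //.
- move=> n; apply/measurable_EFinP; apply: measurable_fun_ifT => //.
    apply: measurable_and; apply: (measurable_fun_bool true); rewrite setTI.
      exact: (measurable_poisson_index [set k | (k < n)%N] measurable_even_bits).
    exact: (measurable_poisson_index [set k | (k < n)%N] measurable_odd_bits).
  by apply: measurable_funX; exact: measurable_step.
- by move=> n y _; rewrite /g lee_fin; case: ifP => // _; exact: sqr_ge0.
- move=> y _ m n mn; rewrite /g lee_fin; case: ifPn => [/andP[ym yn]|_].
    by rewrite (leq_trans ym mn) (leq_trans yn mn).
  by case: ifP => // _; exact: sqr_ge0.
Unshelve. all: by end_near. Qed.

End poisson_index.

(** * Isometric embedding of square-summable arrays *)

Section l2_embedding.
Context {R : realType}.
Local Notation W := (measurableTypeR R).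
Local Notation P := (@uniform01 R).

Definition square_bounded (c : nat -> nat -> R) := exists M, forall n, box c n <= M.

Lemma box_nondecreasing (c : nat -> nat -> R) : nondecreasing_seq (box c).
Proof.
apply/nondecreasing_seqP => n; rewrite /box big_ord_recr/=.
apply: ler_wpDr; first by apply: sumr_ge0 => i _; exact: sqr_ge0.
by apply: ler_sum => k _; rewrite big_ord_recr/= lerDl sqr_ge0.
Qed.

Lemma is_cvg_box (c : nat -> nat -> R) : square_bounded c -> cvgn (box c).
Proof.
move=> [M cM]; apply: nondecreasing_is_cvgn; first exact: box_nondecreasing.
by exists M => _ [n _ <-].
Qed.

Lemma integral_sqr_step (c : nat -> nat -> R) : square_bounded c ->
  (\int[lebesgue01 R]_y (step c y ^+ 2)%:E = (limn (box c))%:E)%E.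
Proof.
move=> cb; rewrite -[LHS]/(\int[P]_y (step c y ^+ 2)%:E)%E.
apply: (cvg_unique _ (cvg_box (R := R) (c := c))) => //.
apply: cvg_EFin; first by near=> n.
exact: is_cvg_box.
Unshelve. all: by end_near. Qed.

Lemma square_boundedD a (c c' : nat -> nat -> R) :
  square_bounded c -> square_bounded c' ->
  square_bounded (fun k i => a * c k i + c' k i).
Proof.
(* The bound comes from (s + t)^2 <= 2 s^2 + 2 t^2. *)
move=> [M cM] [M' cM']; exists (2 * (a ^+ 2 * M) + 2 * M') => n.
apply: (@le_trans _ _ (2 * (a ^+ 2 * box c n) + 2 * box c' n)).
  rewrite /box !mulr_sumr -big_split/=; apply: ler_sum => k _.
  rewrite !mulr_sumr -big_split/=; apply: ler_sum => i _.
  by have := sqr_ge0 (a * c k i - c' k i); nra.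
by rewrite lerD// ler_wpM2l// ler_wpM2l// sqr_ge0.
Qed.

Lemma Lnorm2_step (c : nat -> nat -> R) : square_bounded c ->
  ('N[lebesgue01 R]_2%:E[EFin \o (step c : W -> R)] = (Num.sqrt (limn (box c)))%:E)%E.
Proof.
move=> cb; rewrite unlock /Lnorm.
have -> : (\int[lebesgue01 R]_y (`|(EFin \o (step c : W -> R)) y| `^ 2) =
   (limn (box c))%:E)%E.
  rewrite -integral_sqr_step//; apply: eq_integral => y _ /=.
  by rewrite -[LHS]/((`|step c y| `^ 2)%R%:E) powR_mulrn// real_normK// num_real.
rewrite -[LHS]/((limn (box c) `^ 2^-1)%R%:E) powR12_sqrt//.
apply: limr_ge; first exact: is_cvg_box.
by near=> n; exact: box_ge0.
Unshelve. all: by end_near. Qed.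

Lemma step_Lfun (c : nat -> nat -> R) : square_bounded c ->
  (step c : W -> R) \in Lfun (lebesgue01 R) 2%:E.
Proof.
move=> cb; apply/andP; split; rewrite inE /=.
  exact: measurable_step.
by rewrite /finite_norm Lnorm2_step// ltry.
Qed.

(** Arrays that are not square summable get the default value 0; linearity and isometry are claimed
    under [square_bounded] only. *)
Definition l2_embed (c : nat -> nat -> R) : L2 R :=
  if pselect (square_bounded c) is left cb then Lclass (Lfun_Sub (lee1n 2) (step_Lfun cb))
  else 0.

Lemma l2_embedD a (c c' : nat -> nat -> R) : square_bounded c -> square_bounded c' ->
  l2_embed (fun k i => a * c k i + c' k i) = a *: l2_embed c + l2_embed c'.
Proof.
move=> cb cb'; have cbD := square_boundedD a cb cb'; rewrite /l2_embed.
case: pselect => // h1; case: pselect => // h2; case: pselect => // h3.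
rewrite -[RHS]/(Lspace_add (Lspace_scale a (Lclass _)) (Lclass _)).
rewrite Lclass_scale Lclass_add; apply/LclassP; apply: filterE => y _.
exact: stepD.
Qed.

Lemma l2_embed_norm (c : nat -> nat -> R) : square_bounded c ->
  `|l2_embed c| = Num.sqrt (limn (box c)).
Proof.
move=> cb; rewrite /l2_embed; case: pselect => // h.
rewrite -[LHS]/(Lspace_norm _) Lspace_norm_class.
by apply: EFin_inj; rewrite -Lnorm2_step// fineK// Lnorm2_step.
Qed.

End l2_embedding.

(** * The random operator *)

Section coefficients.
Context {R : realType}.
Local Notation W := (measurableTypeR R).
Local Notation P := (@uniform01 R).

Definition kappa : R := fine jump_rate.

Lemma kappaE : jump_rate = kappa%:E.
Proof. by rewrite fineK// ge0_fin_numE; have /andP[/ltW] := @jump_rate_fin R. Qed.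

Lemma kappa_gt0 : 0 < kappa.
Proof. by rewrite -lte_fin -kappaE; have /andP[] := @jump_rate_fin R. Qed.

Definition coef (x : W -> R) (w : W) k i : R :=
  if occurs k i w then
    x (even_bits (mark k i w)) / (kappa * (k%:R + (odd_bits (mark k i w) : R)))
  else 0.

Lemma measurable_coef x k i : measurable_fun setT x ->
  measurable_fun setT (fun w => coef x w k i).
Proof.
move=> mx; apply: measurable_fun_ifT => //; first exact: measurable_occurs.
apply: measurable_funM.
  apply: (measurableT_comp mx); apply: measurableT_comp; first exact: measurable_even_bits.
  exact: measurable_mark.
apply: (measurableT_comp (@measurable_inv R)); apply: measurable_funM => //.
apply: measurable_funD => //; apply: measurableT_comp; first exact: measurable_odd_bits.
exact: measurable_mark.
Qed.

Lemma measurable_box (c : W -> nat -> nat -> R) n :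
  (forall k i, measurable_fun setT (fun w => c w k i)) ->
  measurable_fun setT (fun w => box (c w) n).
Proof.
move=> mc; apply: measurable_sum => k; apply: measurable_sum => i.
exact: measurable_funX.
Qed.

Lemma cvg_laplace_box (x : W -> R) (N l : R) : measurable_fun setT x ->
  (\int[P]_u `|x u|%:E = N%:E)%E -> 0 <= l ->
  ((\int[P]_w (expR (- (l * box (coef x w) n)))%:E) @[n --> \oo] -->
    (expR (- (Num.sqrt l * N)))%:E)%E.
Proof.
move=> mx xN l0.
(* Chosen so that l times a squared coefficient is the jump energy [h]; the division by [kappa] then
   cancels [jump_rate]. *)
pose a u := Num.sqrt l * x u / kappa.
have ma : measurable_fun setT a by apply: measurable_funM => //; exact: measurable_funM.
pose h (k : nat) (y : W) := (a (even_bits y) / (k%:R + (odd_bits y : R))) ^+ 2.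
have mh k : measurable_fun setT (h k).
  apply: measurable_funX; apply: measurable_funM.
    by apply: (measurableT_comp ma); exact: measurable_even_bits.
  apply: (measurableT_comp (@measurable_inv R)); apply: measurable_funD => //.
  exact: measurable_odd_bits.
have h0 k w : 0 <= h k w by exact: sqr_ge0.
pose q k := fine (\int[P]_y (expR (- h k y))%:E)%E.
have hq k : (\int[P]_y (expR (- h k y))%:E = (q k)%:E)%E.
  rewrite fineK// ge0_fin_numE; last first.
    by apply: integral_ge0 => y _; rewrite lee_fin expR_ge0.
  apply: (@le_lt_trans _ _ (\int[P]_y (1 : R)%:E)%E).
    apply: ge0_le_integral => //.
    - apply/measurable_EFinP; apply: measurableT_comp => //.
      exact: measurableT_comp.
    - by move=> y _; rewrite lee_fin -[leRHS]expR0 ler_expR oppr_le0.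
  by rewrite integral_cst// mul1e lebesgue01_setT ltry.
have aS : (\int[P]_u `|a u|%:E * jump_rate = (Num.sqrt l * N)%:E)%E.
  have -> : (\int[P]_u `|a u|%:E = (Num.sqrt l / kappa)%:E * \int[P]_u `|x u|%:E)%E.
    rewrite -ge0_integralZl//.
    - apply: eq_integral => u _; rewrite -EFinM; congr EFin.
      rewrite /a !normrM normfV (ger0_norm (sqrtr_ge0 l)) (gtr0_norm kappa_gt0).
      by rewrite mulrAC.
    - by apply/measurable_EFinP; exact: measurableT_comp.
    - by rewrite lee_fin divr_ge0 ?sqrtr_ge0// ltW// kappa_gt0.
  rewrite xN kappaE -!EFinM; congr EFin.
  by field; rewrite gt_eqF// kappa_gt0.
have qS := cvg_series_shell ma hq aS.
rewrite (_ : (fun n => _) = (fun n => \int[P]_w (expR (- field_energy h n n w))%:E)%E).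
  exact: cvg_integral_expR_field mh h0 hq qS.
apply/funext => n; apply: eq_integral => w _; congr (expR (- _))%:E.
rewrite /field_energy /box mulr_sumr; apply: eq_bigr => k _.
rewrite mulr_sumr; apply: eq_bigr => i _; rewrite /coef; case: ifP => _.
  rewrite /h /a -[in LHS](sqr_sqrtr l0) -exprMn; congr (_ ^+ 2).
  by rewrite invfM !mulrA.
by rewrite expr0n mulr0.
Qed.

Lemma measurable_square_bounded (c : W -> nat -> nat -> R) :
  (forall k i, measurable_fun setT (fun w => c w k i)) ->
  measurable [set w | square_bounded (c w)].
Proof.
move=> mc; rewrite (_ : [set w | _] = \bigcup_M \bigcap_n
    ((fun w => box (c w) n) @^-1` `]-oo, M%:R]%classic)).
  apply: bigcup_measurable => M _; apply: bigcapT_measurable => n.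
  rewrite -[X in measurable X]setTI; exact: (measurable_box n mc).
apply/seteqP; split => w /=.
  move=> [M cM]; exists (Num.truncn `|M|).+1 => // n _ /=; rewrite in_itv/=.
  apply: le_trans (cM n) _; apply: le_trans (ler_norm _) _; apply/ltW.
  exact: truncnS_gt.
move=> [M _ cM]; exists M%:R => n.
by have := cM n I; rewrite /= in_itv.
Qed.

(** Where the energy is unbounded, exp(- l box) tends to 0. The limiting transform exp(- sqrt l N)
    is therefore at most the probability of summability, and l tends to 0. *)
Lemma coef_square_bounded (x : W -> R) (N : R) : measurable_fun setT x ->
  (\int[P]_u `|x u|%:E = N%:E)%E ->
  P (~` [set w | square_bounded (coef x w)]) = 0%E.
Proof.
move=> mx xN; set G := [set w | _].
have mc k i : measurable_fun setT (fun w => coef x w k i) by exact: measurable_coef.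
have mG : measurable G by exact: measurable_square_bounded.
rewrite probability_setC//.
suff -> : P G = 1%E by rewrite subee.
apply/eqP; rewrite eq_le probability_le1//=.
have lG (l : R) : 0 < l -> ((expR (- (Num.sqrt l * N)))%:E <= P G)%E.
  move=> l0.
  pose f n w := expR (- (l * box (coef x w) n)).
  have f1 n w : f n w <= 1.
    by rewrite -[leRHS]expR0 ler_expR oppr_le0 mulr_ge0 ?box_ge0 ?(ltW l0).
  have mf n : measurable_fun setT (f n).
    apply: measurableT_comp => //; apply: measurableT_comp => //.
    by apply: measurable_funM => //; exact: measurable_box.
  have nf w : nonincreasing_seq (f ^~ w).
    move=> m n mn; rewrite ler_expR lerN2 ler_wpM2l ?(ltW l0)//.
    exact: box_nondecreasing.
  have cf w : cvgn (f ^~ w).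
    by apply: nonincreasing_is_cvgn => //; exists 0 => _ [n _ <-]; exact: expR_ge0.
  have cI : ((\int[P]_w (f n w)%:E)%E @[n --> \oo] --> \int[P]_w (limn (f ^~ w))%:E)%E.
    apply: (@dominated_cvg _ _ _ P setT measurableT _ _ (cst 1%E)) => //.
    - by move=> n; exact/measurable_EFinP.
    - by move=> w _; apply: cvg_EFin; [near=> n|exact: cf].
    - exact: finite_measure_integrable_cst.
    - by move=> n w _; rewrite /= lee_fin ger0_norm ?expR_ge0.
  rewrite (cvg_unique _ (cvg_laplace_box mx xN (ltW l0)) cI)//.
  have -> : P G = (\int[P]_w (\1_G w)%:E)%E by rewrite integral_indic// setIT.
  apply: ge0_le_integral => //.
  - by move=> w _; rewrite lee_fin; apply: limr_ge => //; near=> n; exact: expR_ge0.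
  - apply/measurable_EFinP; apply: (@measurable_fun_cvg _ _ _ _ f); first exact: mf.
    by move=> w _; exact: cf.
  - by apply/measurable_EFinP; exact: measurable_indic.
  - move=> w _; rewrite lee_fin indicE; case: (boolP (w \in G)) => wG.
      apply: limr_le => //; near=> n; exact: f1.
    apply/ler_addgt0Pl => e e0; rewrite addr0.
    (* Above this level of the energy, exp(- l box) is below e. *)
    have [n en] : exists n, - ln e / l < box (coef x w) n.
      apply: contrapT => h; move/negP : wG; apply; rewrite inE /G/=.
      exists (- ln e / l) => n; rewrite leNgt; apply/negP => hn; apply: h.
      by exists n.
    apply: (@le_trans _ _ (f n w)); first exact: nonincreasing_cvgn_ge.
    rewrite /f -[leRHS]lnK ?posrE// ler_expR lerNl ltW//.
    by rewrite mulrC -ltr_pdivrMr.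
have c1 : ((expR (- (Num.sqrt n.+1%:R^-1 * N)))%:E @[n --> \oo] --> (1 : \bar R))%E.
  apply: cvg_EFin; first by near=> n.
  have : expR (- (Num.sqrt (n.+1%:R^-1) * N)) @[n --> \oo] --> expR (- (Num.sqrt (0 : R) * N)).
    apply: continuous_cvg; first exact: continuous_expR.
    apply: cvgN; apply: cvgMl; apply: continuous_cvg; first exact: sqrt_continuous.
    exact: cvg_harmonic.
  by rewrite sqrtr0 mul0r oppr0 expR0.
rewrite -(cvg_lim _ c1)//; apply: lime_le; first by apply: cvgP c1.
by near=> n; apply: lG; rewrite invr_gt0.
Unshelve. all: by end_near. Qed.

End coefficients.

(** * Versions of the random vector T x *)

Section random_operator.
Context {R : realType}.
Local Notation W := (measurableTypeR R).
Local Notation P := (@uniform01 R).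

Lemma uniform01_even_bits (A : set W) : measurable A -> P (even_bits @^-1` A) = P A.
Proof.
move=> mA; have := lebesgue01_bits (R := R) mA measurableT.
rewrite lebesgue01_setT mule1 => <-; congr (lebesgue01 R _).
by apply/seteqP; split => w /=; [split|case].
Qed.

Lemma uniform01_odd_bits (A : set W) : measurable A -> P (odd_bits @^-1` A) = P A.
Proof.
move=> mA; have := lebesgue01_bits (R := R) measurableT mA.
rewrite lebesgue01_setT mul1e => <-; congr (lebesgue01 R _).
by apply/seteqP; split => w /=; [split|case].
Qed.

Lemma uniform01_bit_stream n (A : set W) : measurable A ->
  P (bit_stream n @^-1` A) = P A.
Proof.
elim: n A => [|n ih] A mA; first exact: uniform01_even_bits.
rewrite -[RHS]ih// -[RHS]uniform01_odd_bits.
  by congr (P _); apply/seteqP; split => w /=; rewrite /bit_stream -iterSr.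
by rewrite -[X in measurable X]setTI; apply: measurable_bit_stream.
Qed.

Lemma uniform01_mark k i (A : set W) : measurable A -> P (mark k i @^-1` A) = P A.
Proof.
move=> mA; rewrite -(uniform01_bit_stream i mA).
have m1 : measurable (bit_stream i @^-1` A).
  by rewrite -[X in measurable X]setTI; apply: measurable_bit_stream.
rewrite -(uniform01_odd_bits m1).
have m2 : measurable (odd_bits @^-1` (bit_stream i @^-1` A)).
  by rewrite -[X in measurable X]setTI; apply: measurable_odd_bits.
by rewrite -(uniform01_bit_stream k m2).
Qed.

(** Each position is uniform and there are countably many, so a null set of positions is almost
    surely never hit. Up to null sets, the coordinates thus do not depend on the representative of
    x. *)
Lemma ae_mark (Q : W -> Prop) : (\forall u \ae P, Q u) ->
  \forall w \ae P, forall k i, Q (even_bits (mark k i w)).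
Proof.
move=> [N [mN N0 QN]].
apply: ae_foralln => k; apply: ae_foralln => i.
have mNe : measurable (even_bits @^-1` N).
  by rewrite -[X in measurable X]setTI; apply: measurable_even_bits.
exists (mark k i @^-1` (even_bits @^-1` N)); split.
- by rewrite -[X in measurable X]setTI; apply: measurable_mark.
- apply: etrans (uniform01_mark k i mNe) _.
  by apply: etrans (uniform01_even_bits mN) _.
- by move=> w /= nQ; apply: QN.
Qed.

(** The relation fed to the selection. Measurability and summability hold for every w, so that the
    law of any selected tau can be computed from it; agreement with [coef] is almost sure, which
    leaves room for linearity. *)
Definition l2_coordinates (x : L1 R) (tau : W -> L2 R) := exists c : W -> nat -> nat -> R,
  [/\ (forall k i, measurable_fun setT (fun w => c w k i)),
      (forall w, square_bounded (c w)),
      tau = (fun w => l2_embed (c w)) &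
      \forall w \ae P, forall k i, c w k i = coef (x : W -> R) w k i].

Lemma l2_coordinatesD (a : R) (x y : L1 R) (v w : W -> L2 R) :
  l2_coordinates x v -> l2_coordinates y w ->
  l2_coordinates (a *: x + y) (a *: v + w).
Proof.
move=> [c [mc bc -> cx]] [c' [mc' bc' -> cy]].
exists (fun w k i => a * c w k i + c' w k i); split.
- by move=> k i; apply: measurable_funD => //; exact: measurable_funM.
- by move=> z; exact: square_boundedD.
- by apply/funext => z; rewrite l2_embedD.
(* The chosen representative of a x + y is the combination of those of x and y only almost
   everywhere; [ae_mark] transfers this to the marks. *)
have xyE : \forall u \ae P, ((a *: x + y : L1 R) : W -> R) u = a * (x : W -> R) u + (y : W -> R) u.
  have h1 := LclassE (Lrepr (a *: x) + Lrepr y).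
  have h2 := LclassE (a *: Lrepr x).
  apply: filterS2 h1 h2 => u /(_ I) h1 /(_ I) h2.
  exact: etrans h1 (congr1 (fun z => z + _) h2).
apply: filterS3 cx cy (ae_mark xyE) => z cx cy xy k i.
rewrite cx cy /coef; case: ifP => _; last by rewrite mulr0 addr0.
by rewrite xy mulrDl mulrA.
Qed.

Lemma measurable_L1 (x : L1 R) : measurable_fun setT (x : W -> R).
Proof. exact: (Lfun_measurableTypeR (Lrepr x)). Qed.

Lemma integral_norm_L1 (x : L1 R) :
  (\int[P]_u `|(x : W -> R) u|%:E = (`|x|)%:E)%E.
Proof.
have := finite_norm_fine (Lrepr x); rewrite Lnorm1 => <-.
by rewrite -[RHS]/((Lspace_norm x)%:E) /Lspace_norm Lnorm1.
Qed.

Lemma l2_coordinates_total (x : L1 R) : exists tau, l2_coordinates x tau.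
Proof.
have mx := measurable_L1 x.
pose G := [set w | square_bounded (coef (x : W -> R) w)].
have mG : measurable G by apply: measurable_square_bounded => k i; exact: measurable_coef.
(* Setting the array to 0 on the exceptional null set makes it summable for every w. *)
pose c w : nat -> nat -> R := if `[< G w >] then coef (x : W -> R) w else fun _ _ => 0.
exists (fun w => l2_embed (c w)); exists c; split => //.
- move=> k i; rewrite (_ : (fun w => _) =
      (fun w => if `[< G w >] then coef (x : W -> R) w k i else 0)).
    apply: measurable_fun_ifT => //; last exact: measurable_coef.
    apply: (measurable_fun_bool true); rewrite setTI.
    rewrite (_ : _ @^-1` _ = G)//.
    by apply/seteqP; split => w /=; [move/asboolP|move=> ?; exact/asboolP].
  by apply/funext => w; rewrite /c; case: ifP.
- move=> w; rewrite /c; case: asboolP => // _; exists 0 => n.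
  rewrite /box big1// => k _; rewrite big1// => i _; by rewrite expr0n.
- exists (~` G); split.
  + exact: measurableC.
  + exact: coef_square_bounded (integral_norm_L1 x).
  + move=> w /= nw Gw; apply: nw => k i; rewrite /c; case: asboolP => //.
Qed.
End random_operator.

(** * Law of the normalised norm *)

Section law.
Context {R : realType}.
Local Notation W := (measurableTypeR R).
Local Notation P := (@uniform01 R).

Lemma l2_coordinates_law (x : L1 R) (tau : W -> L2 R) : x != 0 ->
  l2_coordinates x tau ->
  has_density_on P (fun w => `|tau w| / `|x|) `]0, +oo[ target_density.
Proof.
move=> x0 [c [mc bc tauE cx]].
have N0 : 0 < `|x| by rewrite normr_gt0.
have XE w : `|tau w| = Num.sqrt (limn (box (c w))) by rewrite tauE l2_embed_norm.
have lim0 w : 0 <= limn (box (c w)).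
  apply: limr_ge; first exact: is_cvg_box.
  by near=> n; exact: box_ge0.
have mlim : measurable_fun setT (fun w => limn (box (c w))).
  apply: (@measurable_fun_cvg _ _ _ _ (fun n w => box (c w) n)).
    by move=> n; exact: measurable_box.
  by move=> w _; exact: is_cvg_box.
apply: has_density_of_laplace.
- apply: measurable_funM => //; under eq_fun do rewrite XE.
  apply: (measurableT_comp (f := @Num.sqrt R)) => //.
  by apply: continuous_measurable_fun; exact: sqrt_continuous.
- by move=> w; rewrite divr_ge0.
(* The normalisation by |x| is absorbed in the Laplace parameter: sqrt l * |x| = sqrt i. *)
move=> i; pose l : R := i%:R / `|x| ^+ 2.
have l0 : 0 <= l by rewrite divr_ge0// sqr_ge0.
have cI : ((\int[P]_w (expR (- (l * box (c w) n)))%:E)%E @[n --> \oo] -->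
    \int[P]_w (expR (- (i%:R * (`|tau w| / `|x|) ^+ 2)))%:E)%E.
  apply: (@dominated_cvg _ _ _ P setT measurableT _ _ (cst 1%E)) => //.
  - move=> n; apply/measurable_EFinP; apply: measurableT_comp => //.
    apply: measurableT_comp => //; apply: measurable_funM => //.
    exact: measurable_box.
  - move=> w _; apply: cvg_EFin; first by near=> n.
    have -> : i%:R * (`|tau w| / `|x|) ^+ 2 = l * limn (box (c w)).
      by rewrite exprMn exprVn XE sqr_sqrtr// /l mulrA mulrAC.
    apply: continuous_cvg; first exact: continuous_expR.
    by apply: cvgN; apply: cvgMr; exact: is_cvg_box.
  - exact: finite_measure_integrable_cst.
  - move=> n w _; rewrite /= lee_fin ger0_norm ?expR_ge0//.
    by rewrite -[leRHS]expR0 ler_expR oppr_le0 mulr_ge0 ?box_ge0.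
have mx := measurable_L1 x.
have := cvg_laplace_box mx (integral_norm_L1 x) l0.
have -> : Num.sqrt l * `|x| = Num.sqrt i%:R.
  rewrite /l sqrtrM// sqrtrV ?sqr_ge0// sqrtr_sqr ger0_norm//.
  by rewrite divfK// gt_eqF.
(* The limit is known for [coef]; almost sure equality of the arrays equates the truncated integrals
   at each n. *)
rewrite (_ : (fun n => _) = (fun n => \int[P]_w (expR (- (l * box (c w) n)))%:E)%E).
  exact: cvg_unique cI.
apply/funext => n; apply: ge0_ae_eq_integral => //.
- apply/measurable_EFinP; apply: measurableT_comp => //.
  apply: measurableT_comp => //; apply: measurable_funM => //.
  by apply: measurable_box => k j; exact: measurable_coef.
- apply/measurable_EFinP; apply: measurableT_comp => //.
  apply: measurableT_comp => //; apply: measurable_funM => //.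
  exact: measurable_box.
- move: cx; apply: filterS => w cw _; congr (expR (- (l * _)))%:E.
  by apply: eq_bigr => k _; apply: eq_bigr => j _; rewrite cw.
Unshelve. all: by end_near. Qed.

End law.

Theorem lemma1p2 (R : realType) :
  exists (d : measure_display) (Omega : measurableType d)
         (P : probability Omega R) (T : Omega -> {linear L1 R -> L2 R}),
    forall x : L1 R, x != 0 ->
      has_density_on P (fun omega => `|T omega x| / `|x|) `]0, +oo[
        (fun t => expR (- (1 / (4 * t ^+ 2))) / (t ^+ 2 * Num.sqrt pi)).
Proof.
have [T QT] := linear_selection (@l2_coordinatesD R) (@l2_coordinates_total R).
(* The selection takes values in functions on the probability space, with pointwise operations;
   evaluation at w is linear, hence so is [S w] for every w. *)
pose S w x := T x w.
have Slin w : linear (S w).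
  by move=> a x y; rewrite /S linearP.
exists _, (measurableTypeR R), uniform01.
exists (fun w => HB.pack_for {linear L1 R -> L2 R} (S w)
  (GRing.isLinear.Build _ _ _ _ (S w) (Slin w))).
by move=> x x0; exact: l2_coordinates_law (QT x).
Qed.
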